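(* Let $\aleph$ be an infinite cardinal, $\mathbb K$ a field, and $I$ a nonempty $\aleph$-poset having a finite cofinal subset. Then: (1) $\mathfrak B(I)$ is prime if and only if $I$ is downward directed; (2) $\mathfrak B(I)$ is right primitive if and only if $I$ has a coinitial chain, if and only if $\mathfrak B(I)$ is left primitive.
   Context: A poset $I$ is downward directed if any two elements of $I$ have a common lower bound in $I$; a coinitial chain of $I$ is a totally ordered subset $C\subseteq I$ such that for every $i\in I$ there is $c\in C$ with $c\le i$. A ring is right (left) primitive if it has a faithful simple right (left) module. Conventions. $\aleph$ is an infinite cardinal, regarded as an initial ordinal, so that $\emptyset\in\aleph$; $\mathbb K$ is a field. For a poset $P$, $\mathcal M(P)$ is the set of all maximal chains of $P$ (maximal totally ordered subsets). An $\aleph$-poset is a partially ordered set $I$ with $|I|\le\aleph$ and $|\mathcal M(I)|\le\aleph$. For $i\in I$: $\{i\le\}=\{k\in I: i\le k\}$, $\{\le i\}=\{k\in I:k\le i\}$, $\{i\not\le\}=I\setminus\{i\le\}$, with the induced orders. For a set $A$, $\aleph^{(A)}$ is the set of maps $p:A\to\aleph$ with $p(a)=\emptyset$ for all but finitely many $a\in A$. For a set $X$, $\mathrm{CFM}_X(\mathbb K)$ is the $\mathbb K$-algebra of column-finite $X\times X$ matrices over $\mathbb K$, and $\mathrm{FR}_X(\mathbb K)$ is its ideal of matrices with only finitely many nonzero rows; $a(x,y)$ denotes the entry of $a$ in row $x$, column $y$. Construction. Let $X(I)=\aleph^{(I)}\times\mathcal M(I)$ and $Q(I)=\mathrm{CFM}_{X(I)}(\mathbb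 K)$. For $i\in I$ let $X(i\le)=\aleph^{(\{i\le\})}\times\mathcal M(\{i\le\})$ and let $\psi_{I,i}:\mathrm{CFM}_{X(i\le)}(\mathbb K)\to Q(I)$ be the injective (not necessarily unital) $\mathbb K$-algebra homomorphism given, for $p,q\in\aleph^{(I)}$ and $A,B\in\mathcal M(I)$, by $$\psi_{I,i}(a)((p,A),(q,B))=a\big((p|_{\{i\le\}},A\cap\{i\le\}),(q|_{\{i\le\}},B\cap\{i\le\})\big)$$ if $i\in A\cap B$, $A\cap\{\le i\}=B\cap\{\le i\}$ and $p|_{\{i\not\le\}}=q|_{\{i\not\le\}}$, and $\psi_{I,i}(a)((p,A),(q,B))=0$ otherwise. Put $H(I,i)=\psi_{I,i}(\mathrm{FR}_{X(i\le)}(\mathbb K))$ if $i$ is not a maximal element of $I$, and $H(I,i)=\mathbb K\,\psi_{I,i}(\mathbf 1)$ if $i$ is a maximal element of $I$. Put $\mathfrak B(I)=\sum_{i\in I}H(I,i)\subseteq Q(I)$; this sum is direct and, when $I$ has a finite cofinal subset, $\mathfrak B(I)$ is a unital $\mathbb K$-subalgebra of $Q(I)$. *)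

(* Defs.v *)
From HB Require Import structures.
From mathcomp Require Import all_boot all_order all_algebra finmap.
From mathcomp Require Import all_classical.

Set Implicit Arguments.
Unset Strict Implicit.
Unset Printing Implicit Defensive.

Import Order.TTheory GRing.Theory.

Local Open Scope card_scope.
Local Open Scope classical_set_scope.
Local Open Scope ring_scope.

Section RingNotions.
Variable R : pzRingType.

Definition two_sided_ideal (J : set R) : Prop :=
  [/\ J 0, forall a b, J a -> J b -> J (a - b) &
      forall r a, J a -> J (r * a) /\ J (a * r)].

Definition prime_ring : Prop :=
  (exists a : R, a != 0) /\
  forall J L : set R, two_sided_ideal J -> two_sided_ideal L ->
    (forall a b, J a -> L b -> a * b = 0) ->
    J = [set 0] \/ L = [set 0].

Definition simple_module (M : lmodType R) : Prop :=
  (exists v : M, v != 0) /\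
  forall N : {pred M}, submod_closed N -> (N =i pred1 0) \/ (N =i predT).

Definition faithful_module (M : lmodType R) : Prop :=
  forall a : R, (forall v : M, a *: v = 0) -> a = 0.

Definition left_primitive : Prop :=
  exists M : lmodType R, simple_module M /\ faithful_module M.

End RingNotions.

(* Right modules over [R] are left modules over the converse ring [R^c]. *)
Definition right_primitive (R : pzRingType) : Prop := left_primitive R^c.

Section ColumnFinite.
Variables (K : fieldType) (X : choiceType).

Definition colfinite : {pred X -> X -> K} :=
  fun a => `[< forall y, finite_set [set x | a x y != 0] >].

Record cfm := Cfm { cfm_val :> X -> X -> K ; _ : cfm_val \in colfinite }.

HB.instance Definition _ := [isSub for cfm_val].
HB.instance Definition _ := [Choice of cfm by <:].

Lemma colfiniteP (a : X -> X -> K) :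
  reflect (forall y, finite_set [set x | a x y != 0]) (a \in colfinite).
Proof. exact: asboolP. Qed.

Lemma cfm_finite (a : cfm) y : finite_set [set x | a x y != 0].
Proof. by case: a => a /= /colfiniteP. Qed.

Lemma cfmP (a b : cfm) : (forall x y, a x y = b x y) <-> a = b.
Proof.
split=> [ab|->//]; apply/val_inj/funext => x; apply/funext => y; exact: ab.
Qed.


Lemma colfinite_zmod : zmod_closed colfinite.
Proof.
split=> [|a b /colfiniteP fa /colfiniteP fb]; apply/colfiniteP => y.
  by apply: (sub_finite_set _ (finite_set0 X)) => x /=; rewrite eqxx.
have : finite_set ([set x | a x y != 0] `|` [set x | b x y != 0]).
  by rewrite finite_setU.
apply: sub_finite_set => x; rewrite /= -[(a - b) x y]/(a x y - b x y).
have [a0|a0] := eqVneq (a x y) 0; last by left.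
by rewrite a0 sub0r oppr_eq0; right.
Qed.

HB.instance Definition _ :=
  GRing.isZmodClosed.Build (X -> X -> K) colfinite colfinite_zmod.
HB.instance Definition _ := [SubChoice_isSubZmodule of cfm by <:].

Lemma cfmDE (a b : cfm) x y : (a + b) x y = a x y + b x y.
Proof. by []. Qed.

Lemma cfmNE (a : cfm) x y : (- a) x y = - a x y.
Proof. by []. Qed.

Lemma cfm0E x y : (0 : cfm) x y = 0.
Proof. by []. Qed.

Lemma cfm_sumE (J : Type) (s : seq J) (P : pred J) (F : J -> cfm) x y :
  (\sum_(j <- s | P j) F j) x y = \sum_(j <- s | P j) F j x y.
Proof. by elim/big_ind2: _ => // a k b l <- <-; rewrite cfmDE. Qed.

Lemma cfm_scale_subproof k (a : cfm) :
  (fun x y => k * a x y) \in colfinite.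
Proof.
apply/colfiniteP => y; apply: sub_finite_set (cfm_finite a y) => x /=.
by apply: contra_neq => ->; rewrite mulr0.
Qed.
Definition cfm_scale k a := Cfm (cfm_scale_subproof k a).

Lemma cfmZE_subproof k (a : cfm) x y : cfm_scale k a x y = k * a x y.
Proof. by []. Qed.

Fact cfm_scaleA k l a : cfm_scale k (cfm_scale l a) = cfm_scale (k * l) a.
Proof. by apply/cfmP => x y; rewrite !cfmZE_subproof mulrA. Qed.
Fact cfm_scale1 : left_id 1 cfm_scale.
Proof. by move=> a; apply/cfmP => x y; rewrite cfmZE_subproof mul1r. Qed.
Fact cfm_scaleDr : right_distributive cfm_scale +%R.
Proof. by move=> k a b; apply/cfmP => x y; rewrite !(cfmDE, cfmZE_subproof) mulrDr. Qed.
Fact cfm_scaleDl a : {morph cfm_scale^~ a : k l / k + l}.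
Proof. by move=> k l; apply/cfmP => x y; rewrite !(cfmDE, cfmZE_subproof) mulrDl. Qed.
HB.instance Definition _ := GRing.Zmodule_isLmodule.Build K cfm
  cfm_scaleA cfm_scale1 cfm_scaleDr cfm_scaleDl.

Lemma cfmZE k (a : cfm) x y : (k *: a) x y = k * a x y.
Proof. by []. Qed.

Lemma fsum_supp (D : set X) (f : X -> K) :
    (forall z, f z != 0 -> D z) ->
  \sum_(z \in [set: X]) f z = \sum_(z \in D) f z.
Proof.
move=> fD; apply/esym/fsbig_widen => // z [_ nDz] /=.
by apply/eqP; apply: contra_notT nDz; exact: fD.
Qed.

Lemma fsum_neq0 (D : set X) (f : X -> K) :
  \sum_(z \in D) f z != 0 -> exists2 z, D z & f z != 0.
Proof.
move=> s0; apply: contrapT => nz; case/eqP: s0; apply: fsbig1 => z Dz.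
by apply/eqP; apply: contra_notT nz => fz; exists z.
Qed.

(* The sum is over all of [X]; only finitely many terms are nonzero, since
   the column [y] of [b] is finite. *)
Definition cfm_mul_fun (a b : X -> X -> K) x y : K :=
  \sum_(z \in [set: X]) a x z * b z y.

Lemma cfm_mul_subproof (a b : cfm) : cfm_mul_fun a b \in colfinite.
Proof.
apply/colfiniteP => y.
have : finite_set
    (\bigcup_(z in [set z | b z y != 0]) [set x | a x z != 0]).
  apply: bigcup_finite => [|z _]; exact: cfm_finite.
apply: sub_finite_set => x /= /fsum_neq0[z _].
rewrite mulf_eq0 negb_or => /andP[axz bzy]; by exists z.
Qed.
Definition cfm_mul a b := Cfm (cfm_mul_subproof a b).

Lemma cfm_mulE (a b : cfm) (D : set X) x y :
    (forall z, b z y != 0 -> D z) ->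
  cfm_mul a b x y = \sum_(z \in D) a x z * b z y.
Proof.
move=> bD; apply: fsum_supp => z; rewrite mulf_eq0 negb_or => /andP[_].
exact: bD.
Qed.

Lemma cfm_one_subproof : (fun x y : X => (x == y)%:R : K) \in colfinite.
Proof.
apply/colfiniteP => y; apply: sub_finite_set (finite_set1 y) => x /=.
by have [->|] := eqVneq x y; rewrite ?eqxx.
Qed.
Definition cfm_one := Cfm cfm_one_subproof.

Fact cfm_mulA : associative cfm_mul.
Proof.
move=> a b c; apply/cfmP => x y.
pose D := [set w | c w y != 0].
pose E := \bigcup_(w in D) [set z | b z w != 0].
have fD : finite_set D by exact: cfm_finite.
have fE : finite_set E by apply: bigcup_finite => // w _; exact: cfm_finite.
rewrite (@cfm_mulE _ _ E); last first.
  move=> z /fsum_neq0[w _]; rewrite mulf_eq0 negb_or => /andP[bzw cwy].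
  by exists w.
rewrite (@cfm_mulE _ _ D) //.
under eq_fsbigr => z _ do rewrite (@cfm_mulE _ _ D) // mulr_fsumr.
rewrite exchange_fsbig //; apply: eq_fsbigr => w /[!inE] Dw.
rewrite (@cfm_mulE _ _ E); last by move=> z bzw; exists w.
by rewrite mulr_fsuml; apply: eq_fsbigr => z _; rewrite mulrA.
Qed.

Fact cfm_mul1 : left_id cfm_one cfm_mul.
Proof.
move=> a; apply/cfmP => x y /=; rewrite /cfm_mul_fun (@fsum_supp [set x]).
  by rewrite fsbig_set1 eqxx mul1r.
by move=> z; have [->//|] := eqVneq x z; rewrite mul0r eqxx.
Qed.

Fact cfm_mulr1 : right_id cfm_one cfm_mul.
Proof.
move=> a; apply/cfmP => x y /=; rewrite /cfm_mul_fun (@fsum_supp [set y]).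
  by rewrite fsbig_set1 eqxx mulr1.
by move=> z; have [->//|] := eqVneq z y; rewrite mulr0 eqxx.
Qed.

Fact cfm_mulDl : left_distributive cfm_mul +%R.
Proof.
move=> a b c; apply/cfmP => x y; rewrite cfmDE.
pose D := [set w | c w y != 0].
rewrite !(@cfm_mulE _ _ D) // -fsbig_split; last exact: cfm_finite.
by apply: eq_fsbigr => z _; rewrite cfmDE mulrDl.
Qed.

Fact cfm_mulDr : right_distributive cfm_mul +%R.
Proof.
move=> a b c; apply/cfmP => x y; rewrite cfmDE.
pose D := [set z | b z y != 0] `|` [set z | c z y != 0].
have fD : finite_set D by rewrite finite_setU; split; exact: cfm_finite.
rewrite !(@cfm_mulE _ _ D); first last.
- move=> z; rewrite cfmDE; have [b0|b0 _] := eqVneq (b z y) 0; last by left.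
  by rewrite b0 add0r; right.
- by move=> z; left.
- by move=> z; right.
rewrite -fsbig_split //.
by apply: eq_fsbigr => z _; rewrite cfmDE mulrDr.
Qed.

HB.instance Definition _ := GRing.Zmodule_isPzRing.Build cfm
  cfm_mulA cfm_mul1 cfm_mulr1 cfm_mulDl cfm_mulDr.

Lemma cfmME (a b : cfm) x y :
  (a * b) x y = \sum_(z \in [set: X]) a x z * b z y.
Proof. by []. Qed.

Lemma cfm1E x y : (1 : cfm) x y = (x == y)%:R.
Proof. by []. Qed.

Lemma cfm_scaleAl k (a b : cfm) : k *: (a * b) = (k *: a) * b.
Proof.
apply/cfmP => x y; rewrite cfmZE !cfmME mulr_fsumr.
by apply: eq_fsbigr => z _; rewrite mulrA.
Qed.

Lemma cfm_scaleAr k (a b : cfm) : k *: (a * b) = a * (k *: b).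
Proof.
apply/cfmP => x y; rewrite cfmZE !cfmME mulr_fsumr.
by apply: eq_fsbigr => z _; rewrite cfmZE mulrCA.
Qed.

Definition finite_rows : set cfm :=
  [set a | finite_set [set x | exists y, a x y != 0]].

Lemma finite_rowsMr (a b : cfm) : finite_rows a -> finite_rows (a * b).
Proof.
apply: sub_finite_set => x [y]; rewrite cfmME => /fsum_neq0[z _].
by rewrite mulf_eq0 negb_or => /andP[axz _]; exists z.
Qed.

Lemma finite_rowsMl (a b : cfm) : finite_rows b -> finite_rows (a * b).
Proof.
move=> fb.
have : finite_set (\bigcup_(z in [set z | exists y, b z y != 0])
                     [set x | a x z != 0]).
  by apply: bigcup_finite => // z _; exact: cfm_finite.
apply: sub_finite_set => x [y]; rewrite cfmME => /fsum_neq0[z _].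
rewrite mulf_eq0 negb_or => /andP[axz bzy].
by exists z => //; exists y.
Qed.

Lemma finite_rows0 : finite_rows 0.
Proof.
apply: (sub_finite_set _ (finite_set0 X)) => x [y].
by rewrite cfm0E eqxx.
Qed.

Lemma finite_rowsD (a b : cfm) :
  finite_rows a -> finite_rows b -> finite_rows (a + b).
Proof.
move=> fa fb; have : finite_set ([set x | exists y, a x y != 0] `|`
                                 [set x | exists y, b x y != 0]).
  by rewrite finite_setU.
apply: sub_finite_set => x [y]; rewrite cfmDE.
have [a0|a0 _] := eqVneq (a x y) 0; last by left; exists y.
by rewrite a0 add0r => b0; right; exists y.
Qed.

Lemma finite_rowsZ k (a : cfm) : finite_rows a -> finite_rows (k *: a).
Proof.
apply: sub_finite_set => x [y]; rewrite cfmZE mulf_eq0 negb_or.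
by move=> /andP[_ axy]; exists y.
Qed.

End ColumnFinite.

Section ColumnFiniteAlgebra.
Variables (K : fieldType) (X : pointedType).

Fact cfm_oner_neq0 : (1 : cfm K X) != 0.
Proof.
apply/eqP => /cfmP/(_ point point)/eqP.
by rewrite cfm1E cfm0E eqxx oner_eq0.
Qed.
HB.instance Definition _ :=
  GRing.PzSemiRing_isNonZero.Build (cfm K X) cfm_oner_neq0.
HB.instance Definition _ :=
  GRing.Lmodule_isLalgebra.Build K (cfm K X) (@cfm_scaleAl K X).
HB.instance Definition _ :=
  GRing.Lalgebra_isAlgebra.Build K (cfm K X) (@cfm_scaleAr K X).

End ColumnFiniteAlgebra.

Section Posets.
Variables (d : Order.disp_t) (I : porderType d).

Definition downward_directed : Prop :=
  forall i j : I, exists k : I, (k <= i)%O /\ (k <= j)%O.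

Definition is_chain (C : set I) : Prop :=
  total_on C (fun x y => (x <= y)%O).

Definition has_coinitial_chain : Prop :=
  exists2 C : set I, is_chain C & forall i, exists2 c, C c & (c <= i)%O.

Definition has_finite_cofinal : Prop :=
  exists2 F : set I, finite_set F & forall i, exists2 f, F f & (i <= f)%O.

Definition max_elt (i : I) : Prop := forall k, (i <= k)%O -> k = i.

(* [maxchains] is the set M(I). *)
Definition maxchains : set (set I) :=
  [set C | is_chain C /\ forall D, is_chain D -> C `<=` D -> D = C].

Definition upset (i : I) := {k : I | (i <= k)%O}.
HB.instance Definition _ i := SubChoice.on (upset i).
HB.instance Definition _ i :=
  [SubChoice_isSubPOrder of upset i by <: with d].

Lemma maxchainsP C : maxchains C <-> is_chain C /\
  forall k, (forall c, C c -> (k <= c)%O \/ (c <= k)%O) -> C k.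
Proof.
split=> -[chC maxC]; split=> //.
  move=> k kC; rewrite -(maxC (C `|` [set k])); first by right.
    move=> x y [Cx|->] [Cy|->]; [exact: chC| | |by left].
    - by have [] := kC _ Cx; [right|left].
    - exact: kC.
  by move=> x; left.
move=> D chD CD; apply/seteqP; split=> // k Dk; apply: maxC => c Cc.
by apply: chD => //; exact: CD.
Qed.

Lemma exists_maxchain : exists C, maxchains C.
Proof.
have [|C [chC maxC]] := @Zorn_bigcup I is_chain.
  move=> F Fch Ftot x y [A FA Ax] [B FB By].
  by have [AB|BA] := Ftot _ _ FA FB;
    [apply: (Fch _ FB) => //; exact: AB|apply: (Fch _ FA) => //; exact: BA].
exists C; split=> // D chD CD; apply: contrapT => DC.
apply: (maxC D) => //; split=> // DC'; apply: DC.
by apply/seteqP.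
Qed.

End Posets.
Arguments maxchains {d} I.

Lemma maxchain_upset (d : Order.disp_t) (I : porderType d) (A : set I) i :
    maxchains I A -> A i ->
  maxchains (upset i) ((\val : upset i -> I) @^-1` A).
Proof.
move=> /maxchainsP[chA maxA] Ai; apply/maxchainsP; split=> [x y Ax Ay|k kA].
  exact: chA.
apply: maxA => a Aa; have [ia|ai] := chA _ _ Ai Aa.
  exact: (kA (exist _ a ia)).
by right; apply: le_trans ai (valP k).
Qed.

(* An infinite cardinal, regarded as an initial ordinal, is an infinite
   well-ordered type that does not inject into any of its proper initial
   segments; its least element [\bot] is the ordinal 0, i.e. the empty set. *)
Definition infinite_cardinal (d : Order.disp_t) (T : bOrderType d) : Prop :=
  [/\ forall A : set T, A !=set0 -> exists2 m, A m & lbound A m,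
      forall x : T, ~ ([set: T] #<= [set y | (y < x)%O]) &
      infinite_set [set: T]].

Definition aleph_poset (d' : Order.disp_t) (aleph : bOrderType d')
    (d : Order.disp_t) (I : porderType d) : Prop :=
  [set: I] #<= [set: aleph] /\ maxchains I #<= [set: aleph].

Section Construction.
Variables (d' : Order.disp_t) (aleph : bOrderType d') (K : fieldType).

Definition fin_maps (T : Type) : set (T -> aleph) :=
  [set p | finite_set [set t | p t != \bot%O]].
Arguments fin_maps : clear implicits.

Section Index.
Variables (d : Order.disp_t) (I : porderType d).

(* The index set X(I). *)
Definition Xindex : Type := fin_maps I * maxchains I.
HB.instance Definition _ := Choice.on Xindex.

Lemma fin_maps_bot : fin_maps I (fun=> \bot%O).
Proof.
by apply: (sub_finite_set _ (finite_set0 I)) => x; rewrite /= eqxx.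
Qed.

Definition Xindex_point : Xindex :=
  (SigSub (mem_set fin_maps_bot),
   SigSub (mem_set (projT2 (cid (exists_maxchain I))))).
HB.instance Definition _ := isPointed.Build Xindex Xindex_point.

Definition supp_map (x : Xindex) : I -> aleph := val x.1.
Definition chain_of (x : Xindex) : set I := val x.2.

Lemma supp_mapP x : fin_maps I (supp_map x).
Proof. exact: set_mem (valP x.1). Qed.

Lemma chain_ofP x : maxchains I (chain_of x).
Proof. exact: set_mem (valP x.2). Qed.

Lemma chain_total x : is_chain (chain_of x).
Proof. by have [] := chain_ofP x. Qed.

Lemma XindexP x y :
  supp_map x = supp_map y -> chain_of x = chain_of y -> x = y.
Proof.
by case: x y => [p A] [q B] pq AB; congr pair; apply: val_inj.
Qed.


End Index.
Arguments Xindex {d} I.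

Section Psi.
Variables (d : Order.disp_t) (I : porderType d).
Local Notation X := (Xindex I).

Lemma fin_maps_restr (i : I) (p : I -> aleph) : fin_maps I p ->
  fin_maps (upset i) (fun k => p (val k)).
Proof.
move=> fp; apply: (finite_preimage (f := val : upset i -> I) (B := [set k | p k != \bot%O])) => //.
by move=> k l _ _; exact: val_inj.
Qed.

(* The index (p restricted to {i <=}, A `&` {i <=}), for i in A. *)
Definition restr (i : I) (x : X) (xi : chain_of x i) : Xindex (upset i) :=
  (SigSub (mem_set (@fin_maps_restr i _ (supp_mapP x))),
   SigSub (mem_set (maxchain_upset (chain_ofP x) xi))).

(* The condition under which psi takes the entry (x, y) from its argument. *)
Definition same_tag (i : I) (x y : X) : Prop :=
  [/\ chain_of x i, chain_of y i,
      chain_of x `&` [set k | (k <= i)%O] =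
        chain_of y `&` [set k | (k <= i)%O] &
      forall k, ~~ (i <= k)%O -> supp_map x k = supp_map y k].

Definition psi_fun (i : I) (a : cfm K (Xindex (upset i))) (x y : X) : K :=
  match pselect (same_tag i x y) with
  | left (And4 xi yi _ _) => a (restr xi) (restr yi)
  | right _ => 0
  end.

Lemma psi_funE i a x y (xi : chain_of x i) (yi : chain_of y i) :
  same_tag i x y -> psi_fun a x y = a (restr xi) (restr yi).
Proof.
rewrite /psi_fun; case: pselect => // -[xi' yi' _ _] _.
by rewrite (Prop_irrelevance xi xi') (Prop_irrelevance yi yi').
Qed.

Lemma psi_fun0 i (a : cfm K (Xindex (upset i))) x y :
  ~ same_tag i x y -> psi_fun a x y = 0.
Proof. by rewrite /psi_fun; case: pselect. Qed.

Lemma psi_fun_neq0 i (a : cfm K (Xindex (upset i))) x y :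
  psi_fun a x y != 0 -> same_tag i x y.
Proof. by rewrite /psi_fun; case: pselect => //; rewrite eqxx. Qed.

Lemma same_tagC i x y : same_tag i x y -> same_tag i y x.
Proof. by case=> xi yi C p; split=> // k ik; rewrite p. Qed.

Lemma same_tag_trans i x y z :
  same_tag i x y -> same_tag i y z -> same_tag i x z.
Proof.
by case=> xi yi C p [_ zi D q]; split=> //; [rewrite C|move=> k ik; rewrite p // q].
Qed.

Lemma same_tag_refl i x : chain_of x i -> same_tag i x x.
Proof. by []. Qed.

Lemma same_tag_chain i x y k : same_tag i x y -> (k <= i)%O ->
  chain_of x k <-> chain_of y k.
Proof.
case=> _ _ /seteqP[xy yx] _ ki; split=> [xk|yk].
  by have [] := xy k (conj xk ki).
by have [] := yx k (conj yk ki).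
Qed.

(* Gluing an index of the upper set {i <=} onto the part of x off {i <=}. *)
Definition glue_map (i : I) (x : X) (u : Xindex (upset i)) (k : I) : aleph :=
  if insub k is Some k' then supp_map u k' else supp_map x k.

Definition glue_chain (i : I) (x : X) (u : Xindex (upset i)) : set I :=
  [set k | (k <= i)%O /\ chain_of x k] `|` val @` chain_of u.

Lemma glue_mapP i x u : fin_maps I (@glue_map i x u).
Proof.
have : finite_set ([set k | supp_map x k != \bot%O] `|`
    val @` [set k | supp_map u k != \bot%O]).
  by rewrite finite_setU; split; [|apply: finite_image]; exact: supp_mapP.
apply: sub_finite_set => k; rewrite /= /glue_map.
by case: insubP => [k' ik kk' uk|_ xk]; [right; exists k'|left].
Qed.

Lemma upset_bot (i : I) (u : Xindex (upset i)) :
  chain_of u (exist (fun k => (i <= k)%O) i (lexx i)).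
Proof.
have /maxchainsP[_ /(_ (exist _ i (lexx i)))] := chain_ofP u.
by apply=> c _; left; exact: valP c.
Qed.

Lemma glue_chainP i x u : chain_of x i -> maxchains I (@glue_chain i x u).
Proof.
move=> xi; apply/maxchainsP; split.
  move=> k l [[ki xk]|[k' uk <-]] [[li xl]|[l' ul <-]].
  - exact: chain_total xk xl.
  - by left; apply: le_trans ki (valP l').
  - by right; apply: le_trans li (valP k').
  - exact: (chain_total uk ul).
move=> k kC; have [ki|ik] : (k <= i)%O \/ (i <= k)%O.
  by apply: kC; left.
  left; split=> //; have /maxchainsP[_] := chain_ofP x; apply=> c xc.
  have [ci|ic] := chain_total xc xi; first by apply: kC; left.
  by left; apply: le_trans ki ic.
right; exists (exist _ k ik) => //; have /maxchainsP[_] := chain_ofP u.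
by apply=> c uc; apply: (kC (val c)); right; exists c.
Qed.

Definition glue (i : I) (x : X) (xi : chain_of x i) (u : Xindex (upset i)) : X :=
  (SigSub (mem_set (@glue_mapP i x u)), SigSub (mem_set (glue_chainP u xi))).

Lemma glue_in i x xi u : chain_of (@glue i x xi u) i.
Proof. by left. Qed.

Lemma glue_tag i x xi u : same_tag i x (@glue i x xi u).
Proof.
split=> //; first exact: glue_in; last first.
  by move=> k ik; rewrite /supp_map /= /glue_map insubN.
apply/seteqP; split=> k [xk ki]; split=> //; first by left.
case: xk => [[]//|[k' uk kk']]; suff -> : k = i by [].
by apply/le_anti; rewrite ki -kk' (valP k').
Qed.

Lemma glue_supp i x xi u (k : upset i) :
  supp_map (@glue i x xi u) (val k) = supp_map u k.
Proof. by rewrite /supp_map /= /glue_map valK. Qed.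

Lemma glue_val i x xi u (k : upset i) :
  chain_of (@glue i x xi u) (val k) <-> chain_of u k.
Proof.
split=> [[[ki _]|[k' uk /val_inj <-]//]|uk]; last by right; exists k.
suff -> : k = exist _ i (lexx i) by exact: upset_bot.
by apply/val_inj/le_anti; rewrite ki (valP k).
Qed.

Lemma restr_supp i x xi k : supp_map (@restr i x xi) k = supp_map x (val k).
Proof. by []. Qed.

Lemma restr_chain i x xi k : chain_of (@restr i x xi) k <-> chain_of x (val k).
Proof. by []. Qed.

Lemma restr_glue i x xi u gi : @restr i (@glue i x xi u) gi = u.
Proof.
apply: XindexP; first by apply/funext => k; rewrite restr_supp glue_supp.
by apply/seteqP; split=> k /(glue_val xi u k).
Qed.

Lemma glue_inj i x xi : injective (@glue i x xi).
Proof.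
move=> u v uv; have gi := glue_in xi v.
by rewrite -(restr_glue gi); move: gi; rewrite -uv => gi; rewrite restr_glue.
Qed.

Lemma glue_restr i x y (xi : chain_of x i) (yi : chain_of y i) :
  same_tag i x y -> glue xi (restr yi) = y.
Proof.
move=> xy; have tg := same_tag_trans (same_tagC (glue_tag xi (restr yi))) xy.
apply: XindexP.
  apply/funext => k; have [ik|ik] := boolP (i <= k)%O.
    by rewrite (glue_supp xi (restr yi) (exist _ k ik)).
  by case: tg => _ _ _ ->.
apply/seteqP; split=> k gk; have [ki|ik] :
    (k <= i)%O \/ (i <= k)%O.
- exact: chain_total gk (glue_in xi _).
- by apply/(same_tag_chain tg ki).
- by have /glue_val := gk : chain_of (glue xi (restr yi)) (val (exist _ k ik : upset i)).
- exact: chain_total gk yi.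
- by apply/(same_tag_chain tg ki).
- by apply/(glue_val xi (restr yi) (exist _ k ik)).
Qed.

Lemma psi_subproof i (a : cfm K (Xindex (upset i))) :
  psi_fun a \in @colfinite K X.
Proof.
apply/colfiniteP => y; have [yi|yi] := pselect (chain_of y i); last first.
  apply: (sub_finite_set _ (finite_set0 X)) => x /psi_fun_neq0.
  by case=> _ /yi.
have := finite_image (glue yi) (cfm_finite a (restr yi)).
apply: sub_finite_set => x /= axy; have xy := psi_fun_neq0 axy.
have xi : chain_of x i by case: xy.
exists (restr xi); first by rewrite -(psi_funE a xi yi xy).
by apply: glue_restr; exact: same_tagC.
Qed.

Definition psi (i : I) (a : cfm K (Xindex (upset i))) : cfm K X :=
  Cfm (psi_subproof a).


Lemma psiE i (a : cfm K (Xindex (upset i))) x y : psi a x y = psi_fun a x y.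
Proof. by []. Qed.

Lemma psi_neq0 i (a : cfm K (Xindex (upset i))) x y :
  psi a x y != 0 -> same_tag i x y.
Proof. exact: psi_fun_neq0. Qed.

Lemma psiD i (a b : cfm K (Xindex (upset i))) : psi (a + b) = psi a + psi b.
Proof.
apply/cfmP => x y; rewrite cfmDE !psiE /psi_fun.
by case: pselect => [[xi yi _ _]|_]; rewrite ?cfmDE ?addr0.
Qed.

Lemma psiZ i k (a : cfm K (Xindex (upset i))) : psi (k *: a) = k *: psi a.
Proof.
apply/cfmP => x y; rewrite cfmZE !psiE /psi_fun.
by case: pselect => [[xi yi _ _]|_]; rewrite ?cfmZE ?mulr0.
Qed.

Lemma psi0 i : psi (0 : cfm K (Xindex (upset i))) = 0.
Proof. by rewrite -(scale0r (0 : cfm K _)) psiZ scale0r. Qed.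

Lemma psi1E i x y :
  psi (1 : cfm K (Xindex (upset i))) x y = (`[< chain_of x i >] && (x == y))%:R.
Proof.
rewrite psiE /psi_fun; case: pselect => [xy|nxy]; last first.
  case: asboolP => //= xi; have [exy|//] := eqVneq x y.
  by case: nxy; rewrite -exy.
case: (xy) => xi yi _ _; rewrite cfm1E; case: asboolP => //= _.
congr (_%:R); congr nat_of_bool; apply/eqP/eqP => [e|e]; last first.
  by subst y; congr restr; exact: Prop_irrelevance.
by rewrite -(glue_restr xi xi) // e; apply: glue_restr.
Qed.

(* Block-local matrices satisfy [psi a * w = psi (a * w')] and
   [w * psi a = psi (w' * a)] for a suitable [w']. *)
Definition block_local (i : I) (w : cfm K X) : Prop :=
  (forall x y, chain_of x i \/ chain_of y i -> w x y != 0 -> same_tag i x y) /\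
  forall x x' (xi : chain_of x i) (xi' : chain_of x' i) u v,
    w (glue xi u) (glue xi v) = w (glue xi' u) (glue xi' v).

Lemma shrink_subproof i (w : cfm K X) x (xi : chain_of x i) :
  (fun u v => w (glue xi u) (glue xi v)) \in
    @colfinite K (Xindex (upset i)).
Proof.
apply/colfiniteP => v.
apply: (finite_preimage (f := glue xi) (B := [set z | w z (glue xi v) != 0])).
  by move=> p q _ _; exact: glue_inj.
exact: cfm_finite.
Qed.
Definition shrink i (w : cfm K X) x (xi : chain_of x i) :=
  Cfm (shrink_subproof w xi).

Lemma fsum_glue i x (xi : chain_of x i) (f : X -> K) :
    (forall z, f z != 0 -> same_tag i x z) ->
  \sum_(z \in [set: X]) f z =
  \sum_(u \in [set: Xindex (upset i)]) f (glue xi u).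
Proof.
move=> f0; rewrite (@fsum_supp _ _ [set z | same_tag i x z]) //.
apply: reindex_fsbig; split=> [u _|u v _ _|z xz]; [exact: glue_tag|exact: glue_inj|].
by have zi : chain_of z i by [case: xz]; exists (restr zi) => //; apply: glue_restr.
Qed.

Lemma psi_mul_local i (a : cfm K (Xindex (upset i))) w x (xi : chain_of x i) :
  block_local i w -> psi a * w = psi (a * shrink w xi).
Proof.
case=> wtag wglue; apply/cfmP => y z; rewrite cfmME psiE.
have [yz|nyz] := pselect (same_tag i y z); last first.
  rewrite psi_fun0 // fsbig1 // => t _; apply/eqP; rewrite mulf_eq0.
  apply: contra_notT nyz; rewrite negb_or => /andP[/psi_neq0 yt tz].
  by apply: (same_tag_trans yt (wtag _ _ _ tz)); left; case: yt.
have [yi zi _ _] := yz; rewrite (psi_funE _ yi zi) // cfmME.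
rewrite (@fsum_glue i y yi).
  apply: eq_fsbigr => u _; congr (_ * _).
    by rewrite psiE (psi_funE _ yi (glue_in yi u)) ?restr_glue //; exact: glue_tag.
  by rewrite -{1}(glue_restr yi zi yz) (wglue _ _ yi xi).
by move=> t; rewrite mulf_eq0 negb_or => /andP[/psi_neq0].
Qed.

Lemma local_mul_psi i (a : cfm K (Xindex (upset i))) w x (xi : chain_of x i) :
  block_local i w -> w * psi a = psi (shrink w xi * a).
Proof.
case=> wtag wglue; apply/cfmP => y z; rewrite cfmME psiE.
have [yz|nyz] := pselect (same_tag i y z); last first.
  rewrite psi_fun0 // fsbig1 // => t _; apply/eqP; rewrite mulf_eq0.
  apply: contra_notT nyz; rewrite negb_or => /andP[yt /psi_neq0 tz].
  by apply: (same_tag_trans (wtag _ _ _ yt) tz); right; case: tz.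
have [yi zi _ _] := yz; rewrite (psi_funE _ yi zi) // cfmME.
rewrite (@fsum_glue i y yi).
  apply: eq_fsbigr => u _; congr (_ * _); last first.
    rewrite psiE (psi_funE _ (glue_in yi u) zi) ?restr_glue //.
    exact: same_tag_trans (same_tagC (glue_tag _ _)) yz.
  by rewrite -{1}(glue_restr yi yi (same_tag_refl yi)) (wglue _ _ yi xi).
by move=> t; rewrite mulf_eq0 negb_or => /andP[yt _]; apply: wtag yt; left.
Qed.

Lemma glue_tag_upset i x (xi : chain_of x i) (j : upset i) u v :
  same_tag (val j) (glue xi u) (glue xi v) <->
  [/\ chain_of u j, chain_of v j,
      forall k, (k <= j)%O -> chain_of u k <-> chain_of v k &
      forall k, ~~ (j <= k)%O -> supp_map u k = supp_map v k].
Proof.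
split=> [uv|[uj vj C p]].
  split; [by apply/(glue_val xi); case: uv|by apply/(glue_val xi); case: uv| |].
    move=> k kj; rewrite -(glue_val xi u) -(glue_val xi v).
    exact: same_tag_chain uv kj.
  by move=> k jk; rewrite -(glue_supp xi) -(glue_supp xi v); case: uv => _ _ _ ->.
split; [exact/glue_val|exact/glue_val| |].
  apply/seteqP; split=> k [gk kj]; split=> //.
    case: gk => [?|[k' uk kk']]; first by left.
    by right; exists k' => //; apply/C => //; rewrite leEsub kk'.
  case: gk => [?|[k' uk kk']]; first by left.
  by right; exists k' => //; apply/C => //; rewrite leEsub kk'.
move=> k jk; have [ik|ik] := boolP (i <= k)%O.
  have := p (exist _ k ik : upset i) jk.
  by rewrite -(glue_supp xi u) -(glue_supp xi v).
by rewrite /supp_map /= /glue_map !insubN.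
Qed.

Lemma psi_local i j (a : cfm K (Xindex (upset j))) : (i <= j)%O ->
  block_local i (psi a).
Proof.
move=> ij; split=> [x y xyi /psi_neq0 xy|].
  have xiyi := same_tag_chain xy ij.
  split; [by case: xyi => // /xiyi|by case: xyi => // /xiyi| |].
    apply/seteqP; split=> k [ck ki]; split=> //;
      by apply/(same_tag_chain xy (le_trans ki ij)).
  move=> k ik; case: xy => _ _ _; apply; apply: contra ik; exact: le_trans.
move=> x x' xi xi' u v.
pose j' : upset i := exist _ j ij.
have tags := glue_tag_upset xi j' u v; have tags' := glue_tag_upset xi' j' u v.
have [uv|nuv] := pselect (same_tag j (glue xi u) (glue xi v)); last first.
  by rewrite !psiE !psi_fun0 // => /tags'/tags.
have uv' : same_tag j (glue xi' u) (glue xi' v) by apply/tags'/tags.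
have [gu gv _ _] := uv; have [gu' gv' _ _] := uv'.
rewrite !psiE (psi_funE _ gu gv) // (psi_funE _ gu' gv') //.
have restrE w (g : chain_of (glue xi w) j) (g' : chain_of (glue xi' w) j) :
    restr g = restr g'.
  apply: XindexP.
    apply/funext => k; rewrite !restr_supp.
    have ik : (i <= val k)%O by exact: le_trans ij (valP k).
    by rewrite (glue_supp xi w (exist _ (val k) ik)) (glue_supp xi' w (exist _ (val k) ik)).
  apply/funext => k; apply/propext; rewrite !restr_chain.
  have ik : (i <= val k)%O by exact: le_trans ij (valP k).
  by rewrite (glue_val xi w (exist _ (val k) ik)) (glue_val xi' w (exist _ (val k) ik)).
by rewrite (restrE u gu gu') (restrE v gv gv').
Qed.

Lemma shrink_psi i (a : cfm K (Xindex (upset i))) x (xi : chain_of x i) :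
  shrink (psi a) xi = a.
Proof.
apply/cfmP => u v; rewrite -[LHS]/(psi a (glue xi u) (glue xi v)).
rewrite psiE (psi_funE _ (glue_in xi u) (glue_in xi v)) ?restr_glue //.
exact: same_tag_trans (same_tagC (glue_tag _ _)) (glue_tag _ _).
Qed.

Lemma psi_eq0 i (a : cfm K (Xindex (upset i))) :
  (forall x : X, ~ chain_of x i) -> psi a = 0.
Proof.
move=> n; apply/cfmP => x y; rewrite cfm0E psiE psi_fun0 // => -[xi].
by have := n _ xi.
Qed.

Lemma psiM i (a b : cfm K (Xindex (upset i))) : psi (a * b) = psi a * psi b.
Proof.
have [[x xi]|n] := pselect (exists x : X, chain_of x i).
  by rewrite (psi_mul_local a xi (psi_local b (lexx i))) shrink_psi.
by rewrite !psi_eq0 ?mul0r // => x xi; apply: n; exists x.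
Qed.

Lemma psi_incomparable i j a b : ~ ((i <= j)%O \/ (j <= i)%O) ->
  psi (a : cfm K (Xindex (upset i))) * psi (b : cfm K (Xindex (upset j))) = 0.
Proof.
move=> nij; apply/cfmP => x y; rewrite cfmME cfm0E fsbig1 // => z _.
apply/eqP; rewrite mulf_eq0; apply: contra_notT nij; rewrite negb_or.
by move=> /andP[/psi_neq0[_ zi _ _] /psi_neq0[zj _ _ _]]; exact: chain_total zi zj.
Qed.

(* [summand i] is H(I,i), and [frakB_set] is the sum of the H(I,i). *)
Definition summand (i : I) : set (cfm K X) :=
  if pselect (max_elt i) then
    [set k *: psi (1 : cfm K (Xindex (upset i))) | k in [set: K]]
  else @psi i @` @finite_rows K (Xindex (upset i)).

Definition frakB_set : set (cfm K X) :=
  [set m | exists (F : {fset I}) (h : I -> cfm K X),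
     (forall i, summand i (h i)) /\ m = \sum_(i <- F) h i].

Lemma summandZD i k a b : summand i a -> summand i b -> summand i (k *: a + b).
Proof.
rewrite /summand; case: pselect => /= _ [a' ha <-] [b' hb <-].
  by exists (k * a' + b') => //; rewrite scalerDl scalerA.
exists (k *: a' + b'); last by rewrite psiD psiZ.
by apply: finite_rowsD => //; exact: finite_rowsZ.
Qed.

Lemma summand0 i : summand i 0.
Proof.
rewrite /summand; case: pselect => /= _; first by exists 0 => //; rewrite scale0r.
by exists 0; rewrite ?psi0 //; exact: finite_rows0.
Qed.

Lemma summandM i j a b : summand i a -> summand j b ->
  exists k, summand k (a * b).
Proof.
have psi_img l c : summand l c -> exists c', c = @psi l c'.
  rewrite /summand; case: pselect => /= _ [c' _ <-]; last by exists c'.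
  by exists (c' *: 1); rewrite psiZ.
have [ij|nij] := pselect ((i <= j)%O \/ (j <= i)%O); last first.
  move=> /psi_img[a' ->] /psi_img[b' ->]; exists i.
  by rewrite psi_incomparable //; exact: summand0.
have [eij|ne] := eqVneq i j.
  subst j; move=> ha hb; exists i; move: ha hb.
  rewrite /summand; case: pselect => /= _ [a' ha <-] [b' hb <-].
    by exists (a' * b') => //; rewrite -scalerAl -scalerAr -psiM mulr1 scalerA.
  by exists (a' * b'); rewrite ?psiM //; exact: finite_rowsMr.
case: ij => [ij|ji] ha hb.
  exists i; have [b' ->] := psi_img _ _ hb.
  move: ha; rewrite /summand; case: pselect => /= [imax _|_ [a' ha <-]].
    by case/eqP: ne; rewrite (imax _ ij).
  have [[x xi]|n] := pselect (exists x : X, chain_of x i); last first.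
    exists a' => //; rewrite psi_eq0 ?mul0r // => x xi; apply: n; by exists x.
  rewrite (psi_mul_local a' xi (psi_local b' ij)).
  by eexists; [|reflexivity]; exact: finite_rowsMr.
exists j; have [a' ->] := psi_img _ _ ha.
move: hb; rewrite /summand; case: pselect => /= [jmax _|_ [b' hb <-]].
  by case/eqP: ne; rewrite (jmax _ ji).
have [[x xj]|n] := pselect (exists x : X, chain_of x j); last first.
  exists b' => //; rewrite [psi b']psi_eq0 ?mulr0 // => x xi; apply: n; by exists x.
rewrite (local_mul_psi b' xj (psi_local a' ji)).
by eexists; [|reflexivity]; exact: finite_rowsMl.
Qed.

Lemma summand_frakB i a : summand i a -> frakB_set a.
Proof.
move=> ha; exists [fset i]%fset, (fun j => if j == i then a else 0).
split=> [j|]; last by rewrite big_seq_fset1 eqxx.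
by case: eqVneq => [->//|_]; exact: summand0.
Qed.

Lemma frakB0 : frakB_set 0.
Proof.
exists fset0, (fun=> 0); split; last by rewrite big_seq_fset0.
by move=> i; exact: summand0.
Qed.

Lemma frakBZD k a b : frakB_set a -> frakB_set b -> frakB_set (k *: a + b).
Proof.
move=> [F [f [hf ->]]] [G [g [hg ->]]].
pose f' i := if i \in F then f i else 0.
pose g' i := if i \in G then g i else 0.
exists (F `|` G)%fset, (fun i => k *: f' i + g' i); split=> [i|].
  by apply: summandZD; rewrite /f' /g'; case: ifP => _ //; exact: summand0.
rewrite big_split /= -scaler_sumr; congr (_ *: _ + _).
  rewrite -(@big_fset_incl _ _ _ _ _ _ f' (fsubsetUl F G)); last first.
    by move=> i _ iF; rewrite /f' (negbTE iF).
  by rewrite !big_seq; apply: eq_bigr => i iF; rewrite /f' iF.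
rewrite -(@big_fset_incl _ _ _ _ _ _ g' (fsubsetUr F G)); last first.
  by move=> i _ iG; rewrite /g' (negbTE iG).
by rewrite !big_seq; apply: eq_bigr => i iG; rewrite /g' iG.
Qed.

Lemma frakB_sum (J : Type) (s : seq J) (f : J -> cfm K X) :
  (forall j, frakB_set (f j)) -> frakB_set (\sum_(j <- s) f j).
Proof.
move=> hf; elim/big_ind: _ => // [|a b ha hb]; first exact: frakB0.
by rewrite -[a]scale1r; exact: frakBZD.
Qed.

Lemma frakBM a b : frakB_set a -> frakB_set b -> frakB_set (a * b).
Proof.
move=> [F [f [hf ->]]] [G [g [hg ->]]]; rewrite mulr_suml.
apply: frakB_sum => i; rewrite mulr_sumr; apply: frakB_sum => j.
have [k] := summandM (hf i) (hg j); exact: summand_frakB.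
Qed.

Lemma chain_has_max_elt (x : X) : [set: I] !=set0 -> has_finite_cofinal I ->
  exists2 i, chain_of x i & max_elt i.
Proof.
move=> [i0 _] [F /finite_seqP[s ->] cofF].
have /maxchainsP[chx maxx] := chain_ofP x.
have [a0 xa0] : chain_of x !=set0.
  apply: contrapT => x0; apply: (x0); exists i0; apply: maxx => c xc.
  by exfalso; apply: x0; exists c.
have [f [_ xf]] : exists f, f \in s /\ forall a, chain_of x a -> (a <= f)%O.
  apply: contrapT => nf.
  have /(_ s)[//|a xa as_] : forall t : seq I, {subset t <= s} ->
      exists2 a, chain_of x a & forall f, f \in t -> ~ (a <= f)%O.
    elim=> [_|f t IHt fts]; first by exists a0.
    have [g gt|a xa at_] := IHt; first by apply: fts; rewrite inE gt orbT.
    have [b xb bf] : exists2 b, chain_of x b & ~ (b <= f)%O.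
      apply: contrapT => nb; apply: nf; exists f.
      split=> [|b xb]; first by apply: fts; rewrite inE eqxx.
      by apply: contrapT => bf; apply: nb; exists b.
    have [ab|ba] := chx _ _ xa xb.
      exists b => // g; rewrite inE => /orP[/eqP -> //|gt bg].
      by apply: at_ gt _; exact: le_trans bg.
    exists a => // g; rewrite inE => /orP[/eqP -> af|gt]; last exact: at_.
    by apply: bf; exact: le_trans af.
  by have [f fs af] := cofF a; exact: as_ af.
exists f; first by apply: maxx => c /xf; right.
move=> k fk; apply/le_anti; rewrite fk andbT; apply: (xf); apply: maxx => c /xf cf.
by right; exact: le_trans fk.
Qed.

Lemma frakB1 :
  [set: I] !=set0 -> has_finite_cofinal I -> frakB_set 1.
Proof.
move=> I0 hI; have [F fF cofF] := hI.
have fM : finite_set [set i : I | max_elt i].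
  apply: sub_finite_set fF => i imax.
  by have [f Ff /imax <-] := cofF i.
pose h i := if pselect (max_elt i) then @psi i 1 else 0.
have hE i : max_elt i -> h i = @psi i 1 by rewrite /h; case: pselect.
exists (fset_set [set i : I | max_elt i]), h; split=> [i|].
  rewrite /h; case: pselect => imax; last exact: summand0.
  by rewrite /summand; case: pselect => //= _; exists 1 => //; rewrite scale1r.
apply/cfmP => x y; rewrite cfm_sumE cfm1E.
have [i xi imax] := chain_has_max_elt x I0 hI.
rewrite (big_fsetD1 i) /=; last by rewrite in_fset_set // inE.
rewrite big_seq big1 => [|j].
  by rewrite addr0 hE // psi1E; case: asboolP.
rewrite !inE in_fset_set // => /andP[ji /[!inE] jmax].
rewrite hE // psi1E; case: asboolP => //= xj.
by case/eqP: ji; have [/imax|/jmax] := chain_total xi xj.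
Qed.

Variables (I0 : [set: I] !=set0) (hI : has_finite_cofinal I).

(* The two hypotheses are those under which [frakB_set] contains 1. *)
Definition frakB_pred of [set: I] !=set0 & has_finite_cofinal I :
  {pred cfm K X} := fun a => `[< frakB_set a >].

Fact frakB_subalg : subalg_closed (frakB_pred I0 hI).
Proof.
split=> [|k a b /asboolP ha /asboolP hb|a b /asboolP ha /asboolP hb].
- by apply/asboolP; exact: frakB1.
- by apply/asboolP; exact: frakBZD.
- by apply/asboolP; exact: frakBM.
Qed.

Record frakB :=
  FrakB { frakB_val : cfm K X ; _ : frakB_val \in frakB_pred I0 hI }.

HB.instance Definition _ := [isSub for frakB_val].
HB.instance Definition _ := [Choice of frakB by <:].
HB.instance Definition _ :=
  GRing.SubChoice_isSubAlgebra.Build K (cfm K X) _ frakB frakB_subalg.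

End Psi.
End Construction.

(* Main.v *)
(* Each nonzero [a] in B(I) involves finitely many [H(I, i)], and if [k] is below
   all of them then [a] is nonzero on every block of [k]; if [k] is not maximal,
   [H(I, k)] acts on such a block as all finite-rank matrices.  Since [H(I, k) H(I, l)]
   vanishes unless [k] and [l] are comparable, elements of the summands at [i]
   and [j] have a nonzero product [a r b] only if [i] and [j] have a common lower
   bound.

   Given a coinitial chain, extended to a maximal one, the column (row) vectors
   supported on one block of an index [x0] with that chain form a faithful simple
   left (right) module.

   Conversely let [v <> 0] lie in a faithful simple module.  For each [l] some
   [h] in a sum of [H(I, j)], [j] in a finite set [F l] below [l], fixes [v].
   Let [S l] be the set of indices whose chain meets [F l]; then [diag (S l)]
   fixes [h].  If [k] is below [F l] for finitely many [l] then
   [q v = q diag (S l) v] for [q] in the summands below [k], and faithfulness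
   shows that these [S l] intersect.  An ultrafilter [U] containing all [S l]
   yields the coinitial chain of those [j] such that the chains of [U]-almost all
   indices contain [j]. *)

Require Import Defs.
From HB Require Import structures.
From mathcomp Require Import all_boot all_order all_algebra finmap.
From mathcomp Require Import all_classical.

Set Implicit Arguments.
Unset Strict Implicit.
Unset Printing Implicit Defensive.

Import Order.TTheory GRing.Theory.

Local Open Scope card_scope.
Local Open Scope classical_set_scope.
Local Open Scope ring_scope.

(** * Elementwise primeness and faithful simple modules *)

Definition elementwise_prime (R : pzRingType) : Prop :=
  forall a b : R, a != 0 -> b != 0 -> exists r, a * r * b != 0.

Section PrimeRings.
Variable R : pzRingType.

(** If [a * r * b = 0] for all [r], then [a] lies in [J], the left annihilator of $Rb$, and [b] in
    [L], the right annihilator of $JR$; both are ideals and $JL=0$. Conversely, $arb\in JL$ whenever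
    $a\in J$ and $b\in L$. *)
Lemma prime_ringP :
  prime_ring R <-> (exists a : R, a != 0) /\ elementwise_prime R.
Proof.
split=> -[nz primeR]; split=> //.
  move=> a b a0 b0; apply: contrapT => /forallNP arb.
  have {}arb r : a * r * b = 0 by apply/eqP; have /negP/negPn := arb r.
  pose J := [set x : R | forall r, x * r * b = 0].
  pose L := [set y : R | forall x r, J x -> x * r * y = 0].
  have Jideal : two_sided_ideal J.
    split=> [r|x y Jx Jy r|r x Jx]; first by rewrite !mul0r.
      by rewrite !mulrBl Jx Jy subrr.
    by split=> s; [rewrite -!mulrA (mulrA x) Jx mulr0|rewrite -(mulrA x) Jx].
  have Lideal : two_sided_ideal L.
    split=> [x r _|x y Lx Ly z r Jz|r x Lx]; first by rewrite mulr0.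
      by rewrite mulrBr Lx ?Ly ?subrr.
    split=> z s Jz; first by rewrite mulrA -(mulrA z) Lx.
    by rewrite mulrA Lx ?mul0r.
  have JL x y : J x -> L y -> x * y = 0.
    by move=> Jx /(_ x 1 Jx); rewrite mulr1.
  have [J0|L0] := primeR J L Jideal Lideal JL.
    have : J a by []; by rewrite J0 => /= e; rewrite e eqxx in a0.
  have : L b by move=> x r; apply.
  by rewrite L0 => /= e; rewrite e eqxx in b0.
move=> J L [J0 _ JM] [L0 _ LM] JL.
have [/eqP Jn|] := eqVneq J [set 0]; first by left; apply/eqP.
have [->|Ln Jn] := eqVneq L [set 0]; first by right.
have nz_elt (S : set R) : S 0 -> S != [set 0] -> exists2 x, S x & x != 0.
  move=> S0 Sn; apply: contrapT => nx; case/eqP: Sn; apply/seteqP; split.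
    by move=> x Sx; apply: contra_notP nx => /eqP; exists x.
  by move=> x ->.
have [a Ja a0] := nz_elt _ J0 Jn; have [b Lb b0] := nz_elt _ L0 Ln.
have [r] := primeR _ _ a0 b0.
by rewrite -mulrA JL ?eqxx //; case: (LM r b Lb).
Qed.

(** The multiples of [v] form a submodule containing [v], hence all of [M]. *)
Lemma simple_module_gen (M : lmodType R) (v u : M) :
  simple_module M -> v != 0 -> exists r : R, r *: v = u.
Proof.
case=> _ simpleM v0; pose N : {pred M} := fun u => `[< exists r : R, r *: v = u >].
have Nsub : submod_closed N.
  split=> [|r x y]; first by apply/asboolP; exists 0; rewrite scale0r.
  move=> /asboolP[s <-] /asboolP[t <-]; apply/asboolP; exists (r * s + t).
  by rewrite scalerDl scalerA.
have [N0|NT] := simpleM N Nsub.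
  have : v \in N by apply/asboolP; exists 1; rewrite scale1r.
  by rewrite N0 inE (negPf v0).
by have /asboolP : u \in N by rewrite NT.
Qed.

Lemma faithful_module_neq0 (M : lmodType R) (a : R) :
  faithful_module M -> a != 0 -> exists v : M, a *: v != 0.
Proof.
move=> faithM a0; apply: contrapT => nv; case/eqP: a0; apply: faithM => v.
by apply/eqP; apply: contra_notT nv => av; exists v.
Qed.

(** Choose $v$, $u$ with $bv\ne0$ and $au\ne0$; an $r$ carrying $bv$ to $u$ gives $arbv=au\ne0$. *)
Lemma left_primitive_elementwise_prime :
  left_primitive R -> elementwise_prime R.
Proof.
case=> M [simpleM faithM] a b a0 b0.
have [v bv] := faithful_module_neq0 faithM b0.
have [u au] := faithful_module_neq0 faithM a0.
have [r ru] := simple_module_gen u simpleM bv.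
exists r; apply: contraNneq au => arb.
by rewrite -ru !scalerA arb scale0r.
Qed.

End PrimeRings.

(** * Modules realised as subgroups of a larger ring *)

Section SubgroupModule.
Variables (R Q : pzRingType) (phi : R -> Q).
Hypotheses (phi1 : phi 1 = 1) (phiD : {morph phi : a b / a + b})
  (phiM : {morph phi : a b / a * b}).
Variables (M : {pred Q}) (M_zmod : zmod_closed M)
  (M_stable : forall r m, m \in M -> phi r * m \in M).

(* The closure properties are parameters so that the module structure can be
   inferred from the type. *)
Record subgroup_of (clM : zmod_closed M)
    (stM : forall r m, m \in M -> phi r * m \in M) :=
  SubgroupOf { subgroup_val : Q ; _ : subgroup_val \in M }.
Local Notation V := (subgroup_of M_zmod M_stable).

HB.instance Definition _ := [isSub for @subgroup_val M_zmod M_stable].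
HB.instance Definition _ := [Choice of V by <:].
HB.instance Definition _ := GRing.SubChoice_isSubZmodule.Build Q _ V M_zmod.

Definition subgroup_scale (r : R) (m : V) : V :=
  SubgroupOf M_zmod M_stable (M_stable r (valP m)).

Fact subgroup_scaleA a b m :
  subgroup_scale a (subgroup_scale b m) = subgroup_scale (a * b) m.
Proof. by apply: val_inj; rewrite /= phiM mulrA. Qed.

Fact subgroup_scale1 : left_id 1 subgroup_scale.
Proof. by move=> m; apply: val_inj; rewrite /= phi1 mul1r. Qed.

Fact subgroup_scaleDr : right_distributive subgroup_scale +%R.
Proof. by move=> a m n; apply: val_inj; rewrite raddfD; exact: mulrDr. Qed.

Fact subgroup_scaleDl m : {morph subgroup_scale^~ m : a b / a + b}.
Proof. by move=> a b; apply: val_inj; rewrite raddfD /= phiD mulrDl. Qed.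

HB.instance Definition _ := GRing.Zmodule_isLmodule.Build R V
  subgroup_scaleA subgroup_scale1 subgroup_scaleDr subgroup_scaleDl.

(** Simplicity and faithfulness become statements about products in [Q]; taking converse rings for
    [R] and [Q] covers right modules. *)
Lemma left_primitive_subgroup :
    (exists2 m, m \in M & m != 0) ->
    (forall m n, m \in M -> n \in M -> m != 0 -> exists r, phi r * m = n) ->
    (forall r, r != 0 -> exists2 m, m \in M & phi r * m != 0) ->
  left_primitive R.
Proof.
move=> [m0 Mm0 m0n0] gen faith; exists V; split.
  split=> [|N Nsub].
    by exists (SubgroupOf M_zmod M_stable Mm0); apply: contra_neq m0n0 => /(congr1 val).
  have [[m Nm m0']|N0] := pselect (exists2 m, m \in N & m != 0).
    right=> n; apply/idP.
    have mv0 : val m != 0 by apply: contra_neq m0' => e; apply: val_inj.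
    have [r rm] := gen _ _ (valP m) (valP n) mv0.
    have -> : n = r *: m + 0 by apply: val_inj; rewrite addr0 /= rm.
    by case: Nsub => N0; apply.
  left=> m; rewrite !inE; apply/idP/eqP => [Nm|->]; last by case: Nsub.
  by apply/eqP; apply: contra_notT N0 => m0'; exists m.
move=> r r0; apply/eqP; apply: contrapT => /negP /faith[m Mm].
by have /(congr1 val)/= -> := r0 (SubgroupOf M_zmod M_stable Mm); rewrite eqxx.
Qed.

End SubgroupModule.

Lemma left_primitive_division (R : pzRingType) : 1 != 0 :> R ->
  (forall a : R, a != 0 -> exists b, b * a = 1) -> left_primitive R.
Proof.
move=> R10 inv; have predT_zmod : zmod_closed (predT : {pred R}) by [].
apply: (@left_primitive_subgroup R R id erefl _ _ predT predT_zmod) => //.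
- by exists 1.
- move=> m n _ _ /inv[b bm]; exists (n * b).
  by rewrite /= -mulrA bm mulr1.
- by move=> r r0; exists 1; rewrite //= mulr1.
Qed.

(** * Downward directed posets and maximal elements *)

Section Directed.
Variables (d : Order.disp_t) (I : porderType d).

(** The extra bound [k] covers the empty list, and if [k] is not maximal then neither is [m]. *)
Lemma directed_seq (k : I) (s : seq I) : downward_directed I ->
  exists2 m, (m <= k)%O & forall i, i \in s -> (m <= i)%O.
Proof.
move=> dirI; elim: s => [|i s [m mk ms]]; first by exists k.
have [n [nm ni]] := dirI m i; exists n; first exact: le_trans nm mk.
by move=> j; rewrite inE => /orP[/eqP->//|/ms]; exact: le_trans.
Qed.

Lemma coinitial_chain_directed : has_coinitial_chain I -> downward_directed I.
Proof.
move=> [C chC coC] i j; have [c Cc ci] := coC i; have [c' Cc' cj] := coC j.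
have [cc'|c'c] := chC _ _ Cc Cc'.
  by exists c; split=> //; exact: le_trans cc' cj.
by exists c'; split=> //; exact: le_trans c'c ci.
Qed.

Lemma max_elt_ge (i k : I) : ~ max_elt i -> (k <= i)%O -> ~ max_elt k.
Proof. by move=> imax ki kmax; apply: imax; rewrite (kmax _ ki). Qed.

(** The second case is degenerate: with directedness it leaves a single point, where $H(I,i)$
    consists of scalars only. *)
Lemma max_elt_dichotomy : (exists i : I, ~ max_elt i) \/ forall i : I, max_elt i.
Proof.
have [|nmax] := pselect (exists i : I, ~ max_elt i); [by left|right=> i].
by apply: contrapT => ni; apply: nmax; exists i.
Qed.

Lemma directed_max_elt (i j : I) :
  downward_directed I -> (forall k : I, max_elt k) -> i = j.
Proof. by move=> dirI maxI; have [k [/maxI-> /maxI->]] := dirI i j. Qed.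

End Directed.

(** * Lower bounds from primeness, coinitial chains from primitivity *)

(* The hypotheses on [H], [W] and [dg] are invariant under reversing the
   multiplication of [Q], so that left and right modules are treated at once. *)
Section PrimitiveCoinitial.
Variables (d : Order.disp_t) (I : porderType d) (R Q : pzRingType).
Variables (phi : R -> Q) (H : I -> set Q).
Hypotheses (phi_inj : injective phi) (phiD : {morph phi : a b / a + b})
  (phiM : {morph phi : a b / a * b}).
Hypotheses (H_phi : forall i q, H i q -> exists r, phi r = q)
  (H_span : forall r, exists (s : seq I) (h : I -> Q),
     (forall i, H i (h i)) /\ phi r = \sum_(i <- s) h i)
  (H_mul : forall i j a b, H i a -> H j b ->
     a * b = 0 \/ exists k, [/\ (k <= i)%O, (k <= j)%O & H k (a * b)])
  (H_neq0 : forall i, exists2 q, H i q & q != 0).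

Let phi0 : phi 0 = 0.
Proof. by apply: (addIr (phi 0)); rewrite -phiD !add0r. Qed.

(** For $a\in H_i$ and $b\in H_j$, expand the middle factor of $arb\ne0$: a nonzero term lies in
    some $H_l$ with $l\le i$ and $l\le j$. *)
Lemma elementwise_prime_directed : elementwise_prime R -> downward_directed I.
Proof.
move=> primeR i j.
have [a Ha a0] := H_neq0 i; have [b Hb b0] := H_neq0 j.
have [[a' ea] [b' eb]] := (H_phi Ha, H_phi Hb).
have a'0 : a' != 0 by apply: contra_neq a0 => e; rewrite -ea e.
have b'0 : b' != 0 by apply: contra_neq b0 => e; rewrite -eb e.
have [r] := primeR _ _ a'0 b'0.
have [s [h [Hh er]]] := H_span r.
apply: contra_neqP => nk; apply: phi_inj.
rewrite !phiM er ea eb phi0 mulr_sumr mulr_suml big1 // => m _.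
have [->|[k [ki _ Hk]]] := H_mul Ha (Hh m); first by rewrite mul0r.
have [//|[l [lk lj _]]] := H_mul Hk Hb.
by case: nk; exists l; split=> //; exact: le_trans lk ki.
Qed.

(** This is the sum of the [H k] with [k <= l], stable under multiplication by [phi r] on both
    sides. The inductive form lets closure properties be checked one summand at a time. *)
Inductive below (l : I) : Q -> Prop :=
| Below0 : below l 0
| BelowD k a b of (k <= l)%O & H k a & below l b : below l (a + b).

Lemma belowH k l a : (k <= l)%O -> H k a -> below l a.
Proof. by move=> kl Ha; rewrite -[a]addr0; apply: BelowD kl Ha _; exact: Below0. Qed.

Lemma below_add l a b : below l a -> below l b -> below l (a + b).
Proof.
elim=> [|k c e kl Hc _ IH] lb; first by rewrite add0r.
by rewrite -addrA; apply: BelowD kl Hc _; exact: IH.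
Qed.

Lemma below_sum l (s : seq I) (F : I -> Q) :
  (forall i, below l (F i)) -> below l (\sum_(i <- s) F i).
Proof. by move=> lF; elim/big_ind: _ => //; [exact: Below0|exact: below_add]. Qed.

Lemma below_mulr l a r : below l a -> below l (a * phi r).
Proof.
have [s [h [Hh ->]]] := H_span r.
elim=> [|k b c kl Hb _ IH]; first by rewrite mul0r; exact: Below0.
rewrite mulrDl; apply: below_add => //; rewrite mulr_sumr; apply: below_sum => i.
have [->|[m [mk _ Hm]]] := H_mul Hb (Hh i); first exact: Below0.
by apply: belowH Hm; exact: le_trans mk kl.
Qed.

Lemma below_mull l a r : below l a -> below l (phi r * a).
Proof.
have [s [h [Hh ->]]] := H_span r.
elim=> [|k b c kl Hb _ IH]; first by rewrite mulr0; exact: Below0.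
rewrite mulrDr; apply: below_add => //; rewrite mulr_suml; apply: below_sum => i.
have [->|[m [_ mk Hm]]] := H_mul (Hh i) Hb; first exact: Below0.
by apply: belowH Hm; exact: le_trans mk kl.
Qed.

Lemma below_phi l a : below l a -> exists r, phi r = a.
Proof.
elim=> [|k b c _ /H_phi[r <-] _ [t <-]]; first by exists 0.
by exists (r + t).
Qed.

Variables (X : Type) (W : I -> set X) (dg : set X -> Q).
(** In the application [W j] is the set of indices whose chain contains [j], so this is the set of
    those whose chain meets [s], and [dg] gives its diagonal idempotent. *)
Definition cyl (s : seq I) : set X := [set x | exists2 j, j \in s & W j x].
Hypotheses (W_chain : forall x i j, W i x -> W j x -> (i <= j)%O \/ (j <= i)%O)
  (dg0 : dg set0 = 0) (dgT : dg setT = 1)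
  (dgI : forall S T, dg (S `&` T) = dg S * dg T)
  (dg_cyl : forall (s : seq I) j a, j \in s -> H j a -> dg (cyl s) * a = a)
  (H_cyl : forall (s : seq I) k a, ~ max_elt k -> (forall j, j \in s -> (k <= j)%O) ->
     H k a -> H k (a * dg (cyl s))).

(** The list [s] collects the positions of the summands of [a]; a larger cylinder still fixes what a
    smaller one fixes. *)
Lemma below_cyl l a : below l a ->
  exists2 s, (forall j, j \in s -> (j <= l)%O) & dg (cyl s) * a = a.
Proof.
elim=> [|k b c kl Hb _ [s sl sc]]; first by exists [::] => //; rewrite mulr0.
exists (k :: s) => [j|]; first by rewrite inE => /orP[/eqP->//|/sl].
rewrite mulrDr (dg_cyl _ Hb) ?mem_head // -{1}sc mulrA -dgI.
suff -> : cyl (k :: s) `&` cyl s = cyl s by rewrite sc.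
apply/seteqP; split=> [x []//|x [j js Wj]].
by split; exists j => //; rewrite inE js orbT.
Qed.

Lemma below_mul_cyl s l a : ~ max_elt l -> (forall j, j \in s -> (l <= j)%O) ->
  below l a -> below l (a * dg (cyl s)).
Proof.
move=> nmax ls; elim=> [|k b c kl Hb _ IH]; first by rewrite mul0r; exact: Below0.
rewrite mulrDl; apply: BelowD (kl) _ IH; apply: H_cyl => //.
  exact: max_elt_ge nmax kl.
by move=> j /ls; exact: le_trans.
Qed.

(** Two sets of [U] meet, so any [i], [j] with [U (W i)] and [U (W j)] are comparable. An
    ultrafilter containing a finite union contains one of its members, which yields such a [j] in
    each [F l]. *)
Lemma chain_of_ultra (U : set_system X) (F : I -> seq I) :
    UltraFilter U -> (forall l j, j \in F l -> (j <= l)%O) ->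
    (forall l, U (cyl (F l))) ->
  has_coinitial_chain I.
Proof.
move=> UU Fl UF; exists [set j | U (W j)] => [i j Ui Uj|l].
  by have [x [Wi Wj]] := filter_ex (filterI Ui Uj); exact: W_chain Wi Wj.
suff [j jF UWj] : exists2 j, j \in F l & U (W j) by exists j => //; exact: Fl.
apply: contrapT => nj; have {}nj j : j \in F l -> ~ U (W j).
  by move=> jF UWj; apply: nj; exists j.
suff : U (~` cyl (F l)).
  by move=> UC; have [x [Cx nCx]] := filter_ex (filterI (UF l) UC); exact: nCx.
elim: (F l) nj => [_|j s IH nj].
  by apply: filterS filterT => x _ [].
have Us : U (~` cyl s) by apply: IH => k ks; apply: nj; rewrite inE ks orbT.
have [/nj[]|UWj] := in_ultra_setVsetC (W j) UU; first exact: mem_head.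
apply: filterS (filterI UWj Us) => x [nWj nC] [k].
by rewrite inE => /orP[/eqP->//|ks Wk]; apply: nC; exists k.
Qed.

Lemma primitive_coinitial : left_primitive R -> has_coinitial_chain I.
Proof.
move=> primR; have primeR := left_primitive_elementwise_prime primR.
have dirI := elementwise_prime_directed primeR.
have [[i0 nmax0]|maxI] := max_elt_dichotomy I; last first.
  exists setT => [i j _ _|i]; last by exists i.
  by rewrite (directed_max_elt i j dirI maxI); left.
case: primR => M [simpleM faithM]; have [[v v0] _] := simpleM.
have act l : exists (r : R) (u : M), below l (phi r) /\ r *: u != 0.
  have [q Hq q0] := H_neq0 l; have [r er] := H_phi Hq.
  have r0 : r != 0 by apply: contra_neq q0 => e; rewrite -er e.
  have [u ru] := faithful_module_neq0 faithM r0; exists r, u; split=> //.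
  by rewrite er; exact: belowH Hq.
(* [F l] lists the summands of $h=trt'$, where $t'$ carries $v$ to $u$ and $t$ carries $ru$ to $v$.
   Thus $hv=v$, and $h$ lies below [l] because $r$ does. *)
have /choice[F hF] l : exists s : seq I, (forall j, j \in s -> (j <= l)%O) /\
    exists h : R, h *: v = v /\ dg (cyl s) * phi h = phi h.
  have [r [u [rl ru]]] := act l.
  have [t tu] := simple_module_gen v simpleM ru.
  have [t' tv] := simple_module_gen u simpleM v0.
  have lh : below l (phi (t * r * t')).
    by rewrite !phiM; apply: below_mulr; exact: below_mull.
  have [s sl sh] := below_cyl lh; exists s; split=> //; exists (t * r * t').
  by split=> //; rewrite -!scalerA tv tu.
have fip : finI setT (cyl \o F).
  move=> D _; apply: contrapT => nD.
  (* Here [l] is put below all members of [F i] for [i] in [D], and below the nonmaximal [i0], so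
     that [below_mul_cyl] applies. *)
  have [l li0 lD] := directed_seq i0 (flatten [seq F i | i <- D]) dirI.
  have nmaxl := max_elt_ge nmax0 li0.
  (* The cylinders are multiplied on one at a time. The action on $v$ stays the same, since $v=hv$
     and the idempotent of [cyl (F i)] fixes $h$. *)
  have step (s : seq I) r : {subset s <= D} -> below l (phi r) ->
      exists2 r', phi r' = phi r * dg (\bigcap_(i in [set` s]) cyl (F i)) &
        r' *: v = r *: v.
    elim: s r => [r _ _|i s IH r sD lr].
      exists r => //; suff -> : \bigcap_(i in [set` [::]]) cyl (F i) = setT.
        by rewrite dgT mulr1.
      by apply/seteqP; split=> // x _ i.
    have li : below l (phi r * dg (cyl (F i))).
      apply: below_mul_cyl => // j jF; apply: lD; apply/flattenP; exists (F i) => //.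
      by apply: map_f; apply: sD; exact: mem_head.
    have [r' er'] := below_phi li.
    have sD' : {subset s <= D} by move=> j js; apply: sD; rewrite inE js orbT.
    have lr' : below l (phi r') by rewrite er'.
    have [r2 er2 r2v] := IH _ sD' lr'.
    exists r2.
      rewrite er2 er' -mulrA -dgI; congr (_ * dg _).
      apply/seteqP; split=> [x [Fx Dx] j /=|x Dx].
        by rewrite inE => /orP[/eqP->//|]; exact: Dx.
      split=> [|j /= js]; apply: Dx; rewrite /= inE ?eqxx //.
      by have -> : j \in s by []; rewrite orbT.
    rewrite r2v; have [_ [h [hv hh]]] := hF i.
    rewrite -hv !scalerA; congr (_ *: _); apply: phi_inj.
    by rewrite !phiM er' -mulrA hh.
  have [r [u [rl ru]]] := act l.
  have [t tv] := simple_module_gen u simpleM v0.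
  (* If the cylinders had empty intersection, [r'] would be zero, yet $r'v=rtv=ru\ne0$. *)
  have [|r' er' r'v] := step D (r * t) (fun i iD => iD).
    by rewrite phiM; exact: below_mulr.
  move: ru; rewrite -tv scalerA -r'v; suff -> : r' = 0 by rewrite scale0r eqxx.
  apply: phi_inj; rewrite er' phi0; suff -> : \bigcap_(i in [set` D]) cyl (F i) = set0.
    by rewrite dg0 mulr0.
  by apply/seteqP; split=> // x Dx; apply: nD; exists x.
have Uproper := finI_filter fip.
have [U [UU sU]] := ultraFilterLemma Uproper.
apply: (chain_of_ultra UU (F := F)) => [l|l]; first by case: (hF l).
by apply: sU; exists (cyl (F l)) => //; exact: finI_from1.
Qed.

End PrimitiveCoinitial.

(** * Matrix units and diagonal idempotents *)

Section MatrixUnits.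
Variables (K : fieldType) (X : choiceType).
Implicit Types a b q r : cfm K X.

(** This and its mirror image allow a factor to be replaced by one that agrees with it on a single
    block. *)
Lemma cfmM_eql a q r x y :
    (forall z, a x z != 0 -> q z y = r z y) ->
  (a * q) x y = (a * r) x y.
Proof.
move=> qr; rewrite !cfmME; apply: eq_fsbigr => z _.
by have [->|/qr->//] := eqVneq (a x z) 0; rewrite !mul0r.
Qed.

Lemma cfmM_eqr a q r x y :
    (forall z, a z y != 0 -> q x z = r x z) ->
  (q * a) x y = (r * a) x y.
Proof.
move=> qr; rewrite !cfmME; apply: eq_fsbigr => z _.
by have [->|/qr->//] := eqVneq (a z y) 0; rewrite !mulr0.
Qed.

Lemma cfmM_neq0 a b x y : (a * b) x y != 0 -> exists2 z, a x z != 0 & b z y != 0.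
Proof.
rewrite cfmME => /fsum_neq0[z _]; rewrite mulf_eq0 negb_or => /andP[axz bzy].
by exists z.
Qed.

Lemma cfm_neq0 a : a != 0 -> exists x y, a x y != 0.
Proof.
move=> a0; apply: contrapT => na; case/eqP: a0; apply/cfmP => x y.
by rewrite cfm0E; apply/eqP; apply: contra_notT na => axy; exists x, y.
Qed.

Lemma delta_colfinite (s t : X) :
  (fun x y => ((x == s) && (y == t))%:R : K) \in @colfinite K X.
Proof.
apply/colfiniteP => y; apply: (sub_finite_set _ (finite_set1 s)) => x /=.
by case: (x =P s) => [->//|_] /=; rewrite eqxx.
Qed.
Definition delta s t : cfm K X := Cfm (delta_colfinite s t).

Lemma deltaE s t x y : delta s t x y = ((x == s) && (y == t))%:R.
Proof. by []. Qed.

Lemma delta_neq0 s t x y : delta s t x y != 0 -> x = s /\ y = t.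
Proof.
by rewrite deltaE; case: (x =P s) => [->|_]; case: (y =P t) => [->|_] /=;
  rewrite ?eqxx.
Qed.

Lemma delta_finite_rows s t : finite_rows (delta s t).
Proof.
by apply: (sub_finite_set _ (finite_set1 s)) => x [y] /delta_neq0[].
Qed.

Lemma deltaMl s t a x y : (delta s t * a) x y = (x == s)%:R * a t y.
Proof.
rewrite cfmME (@fsum_supp _ _ [set t]) => [|z].
  by rewrite fsbig_set1 deltaE eqxx andbT.
by rewrite mulf_eq0 negb_or => /andP[/delta_neq0[_ ->]].
Qed.

Lemma deltaMr s t a x y : (a * delta s t) x y = a x s * (y == t)%:R.
Proof.
rewrite cfmME (@fsum_supp _ _ [set s]) => [|z].
  by rewrite fsbig_set1 deltaE eqxx.
by rewrite mulf_eq0 negb_or => /andP[_ /delta_neq0[->]].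
Qed.

Lemma deltaM s t u : delta s t * delta t u = delta s u.
Proof. by apply/cfmP => x y; rewrite deltaMr !deltaE eqxx andbT -natrM mulnb. Qed.

Lemma delta_sandwich s t u v a : delta s t * a * delta u v = a t u *: delta s v.
Proof.
apply/cfmP => x y; rewrite deltaMr deltaMl cfmZE deltaE mulrAC mulrC -natrM.
by rewrite mulnb.
Qed.

Lemma diag_colfinite (S : set X) :
  (fun x y => ((x == y) && `[< S x >])%:R : K) \in @colfinite K X.
Proof.
apply/colfiniteP => y; apply: (sub_finite_set _ (finite_set1 y)) => x /=.
by case: (x =P y) => [->//|_] /=; rewrite eqxx.
Qed.
Definition diag S : cfm K X := Cfm (diag_colfinite S).

Lemma diagE S x y : diag S x y = ((x == y) && `[< S x >])%:R.
Proof. by []. Qed.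

Lemma diag_neq0 S x y : diag S x y != 0 -> x = y /\ S x.
Proof.
by rewrite diagE; case: (x =P y) => [->|_]; case: (asboolP (S _)) => //= _;
  rewrite ?eqxx.
Qed.

Lemma diagMl S a x y : (diag S * a) x y = `[< S x >]%:R * a x y.
Proof.
rewrite cfmME (@fsum_supp _ _ [set x]) => [|z].
  by rewrite fsbig_set1 diagE eqxx.
by rewrite mulf_eq0 negb_or => /andP[/diag_neq0[->]].
Qed.

Lemma diagMr S a x y : (a * diag S) x y = a x y * `[< S y >]%:R.
Proof.
rewrite cfmME (@fsum_supp _ _ [set y]) => [|z].
  by rewrite fsbig_set1 diagE eqxx.
by rewrite mulf_eq0 negb_or => /andP[_ /diag_neq0[->]].
Qed.

Lemma diagI S T : diag (S `&` T) = diag S * diag T.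
Proof.
apply/cfmP => x y; rewrite diagMl !diagE asbool_and -natrM mulnb.
by rewrite andbCA.
Qed.

Lemma diag0 : diag set0 = 0.
Proof. by apply/cfmP => x y; rewrite diagE asboolF ?andbF. Qed.

Lemma diagT : diag setT = 1.
Proof. by apply/cfmP => x y; rewrite diagE asboolT ?andbT. Qed.

End MatrixUnits.

(** * Extending chains, and maximal elements of finite lists *)

Section Chains.
Variables (d : Order.disp_t) (I : porderType d).

(** Zorn is applied to the sets [D] whose union with [C] is a chain, rather than to chains
    containing [C], so that the empty union qualifies. *)
Lemma chain_extend (C : set I) : is_chain C -> exists2 A, maxchains I A & C `<=` A.
Proof.
move=> chC; pose P (D : set I) := is_chain (C `|` D).
have [|D [PD maxD]] := @Zorn_bigcup I P.
  move=> F Fch Ftot x y [Cx|[A FA Ax]] [Cy|[B FB By]].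
  - exact: chC.
  - by apply: (Fch _ FB); [left|right].
  - by apply: (Fch _ FA); [right|left].
  - by have [AB|BA] := Ftot _ _ FA FB;
      [apply: (Fch _ FB); right=> //; exact: AB|
       apply: (Fch _ FA); right=> //; exact: BA].
exists (C `|` D); last by move=> x; left.
split=> // E chE CDE; apply: contrapT => ECD.
apply: (maxD E); last first.
  have CE z : (C `|` E) z -> E z by case=> // Cz; apply: CDE; left.
  by move=> x y /CE Ex /CE Ey; exact: chE.
split=> [x Dx|ED]; first by apply: CDE; right.
by apply: ECD; apply/seteqP; split=> // x /ED; right.
Qed.

Lemma chain2 (i j : I) : (i <= j)%O -> is_chain [set i; j].
Proof. by move=> ij x y [] -> [] ->; rewrite ?lexx ?ij; auto. Qed.

(** Serves to pick the topmost nonzero term of a finite sum. *)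
Lemma seq_maximal (s : seq I) (P : I -> Prop) : (exists2 i, i \in s & P i) ->
  exists2 i, i \in s /\ P i & forall j, j \in s -> P j -> (i <= j)%O -> j = i.
Proof.
elim: s => [[]//|k s IH] [i]; rewrite inE => iks Pi.
have [/IH[m [ms Pm] maxm]|ns] := pselect (exists2 i, i \in s & P i); last first.
  have {iks} eik : i = k.
    by case/orP: iks => [/eqP//|is_]; case: ns; exists i.
  subst k; exists i; rewrite ?mem_head // => j; rewrite inE => /orP[/eqP//|js Pj].
  by case: ns; exists j.
have [[Pk mk]|nk] := pselect (P k /\ (m <= k)%O).
  exists k; rewrite ?mem_head // => j; rewrite inE => /orP[/eqP//|js] Pj kj.
  have jm := maxm _ js Pj (le_trans mk kj).
  by apply/le_anti; rewrite kj jm mk.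
exists m; first by rewrite inE ms orbT.
move=> j; rewrite inE => /orP[/eqP->|] // Pk mk; first by case: nk.
exact: maxm.
Qed.

End Chains.

(** * Blocks of indices and the summands $H(I,i)$ *)

Section Blocks.
Variables (d' : Order.disp_t) (aleph : bOrderType d') (K : fieldType).
Variables (d : Order.disp_t) (I : porderType d).
Local Notation X := (Xindex aleph I).
Local Notation Psi i := (@psi d' aleph K d I i).
Implicit Types (x y z : X) (i j k : I) (a b : cfm K X).

(** The two coordinates of an index are independent, so its map can be prescribed along with two
    members of its chain. *)
Lemma exists_index i j (p : I -> aleph) : (i <= j)%O -> fin_maps p ->
  exists x, [/\ chain_of x i, chain_of x j & supp_map x = p].
Proof.
move=> ij fp; have [A mA sA] := chain_extend (chain2 ij).
exists (SigSub (mem_set fp), SigSub (mem_set mA)).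
by split=> //; apply: sA; [left|right].
Qed.

Lemma exists_index_in i : exists x, chain_of x i.
Proof.
by have [x []] := exists_index (lexx i) (@fin_maps_bot _ aleph _ _); exists x.
Qed.

(** The tag at [k] records less of an index than the tag at [i]: blocks grow as [i] decreases. *)
Lemma same_tag_le i k x y :
  (k <= i)%O -> chain_of x k -> same_tag i x y -> same_tag k x y.
Proof.
move=> ki xk xy; split=> //; first exact/(same_tag_chain xy ki).
  apply/seteqP; split=> l [cl lk]; split=> //;
    exact/(same_tag_chain xy (le_trans lk ki)).
by move=> l kl; case: xy => _ _ _; apply; apply: contra kl; exact: le_trans.
Qed.

Lemma block_local0 i : block_local i (0 : cfm K X).
Proof. by split=> // x y _; rewrite cfm0E eqxx. Qed.

Lemma block_localD i a b : block_local i a -> block_local i b -> block_local i (a + b).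
Proof.
move=> [atag aglue] [btag bglue]; split=> [x y xyi|x x' xi xi' u v].
  rewrite cfmDE; have [->|/atag-/(_ xyi)//] := eqVneq (a x y) 0.
  by rewrite add0r; exact: btag.
by rewrite !cfmDE (aglue _ _ xi xi') (bglue _ _ xi xi').
Qed.

Lemma block_local_tag k a x y : block_local k a -> chain_of x k ->
  a x y != 0 -> same_tag k x y.
Proof. by case=> tag _ xk; apply: tag; left. Qed.

Lemma block_local_tagC k a x y : block_local k a -> chain_of y k ->
  a x y != 0 -> same_tag k x y.
Proof. by case=> tag _ yk; apply: tag; right. Qed.

(** A block-local matrix repeats itself on all blocks of [k], so an entry can be transported to the
    block of [x0]. *)
Lemma block_local_move k a x y x0 (xk : chain_of x k) (yk : chain_of y k)
    (x0k : chain_of x0 k) : block_local k a -> same_tag k x y ->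
  a (Defs.glue x0k (restr xk)) (Defs.glue x0k (restr yk)) = a x y.
Proof.
case=> _ aglue xy; rewrite (aglue _ _ x0k xk) (glue_restr xk xk) //.
by rewrite (glue_restr xk yk xy).
Qed.

Lemma summand_psi i a : summand i a ->
  exists a' : cfm K (Xindex aleph (upset i)), a = psi a'.
Proof.
rewrite /summand; case: pselect => /= _ [a' _ <-]; last by exists a'.
by exists (a' *: 1); rewrite psiZ.
Qed.

Lemma summand_nmaxE i : ~ max_elt i ->
  summand i = Psi i @` @finite_rows K (Xindex aleph (upset i)).
Proof. by rewrite /summand; case: pselect. Qed.

Lemma summand_maxE i : max_elt i ->
  summand i = [set k *: Psi i 1 | k in [set: K]].
Proof. by rewrite /summand; case: pselect. Qed.

Lemma summand_local i j a : summand i a -> (j <= i)%O -> block_local j a.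
Proof. by move=> /summand_psi[a' ->]; exact: psi_local. Qed.

Lemma summand_tag i a x y : summand i a -> a x y != 0 -> same_tag i x y.
Proof. by move=> /summand_psi[a' ->]; exact: psi_neq0. Qed.

(** Multiplying [psi a'] by a block-local matrix amounts to multiplying [a'] by its shrunken copy,
    and the matrices with finitely many nonzero rows form an ideal. *)
Lemma local_mul_summand i a b : ~ max_elt i -> block_local i b ->
  summand i a -> summand i (a * b) /\ summand i (b * a).
Proof.
move=> nmax locb; rewrite summand_nmaxE // => -[a' fa' <-].
have [x xi] := exists_index_in i.
rewrite (psi_mul_local a' xi locb) (local_mul_psi a' xi locb).
by split; (eexists; last reflexivity); [exact: finite_rowsMr|exact: finite_rowsMl].
Qed.

Lemma summand_mul_le i j a b : (i <= j)%O -> summand i a -> summand j b ->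
  summand i (a * b) /\ summand i (b * a).
Proof.
move=> ij; have [imax|nmax] := pselect (max_elt i); last first.
  by move=> Ha Hb; apply: local_mul_summand => //; exact: summand_local ij.
have eij := imax _ ij; subst j; rewrite summand_maxE // => -[k _ <-] [l _ <-].
by rewrite -!scalerAl -!scalerAr -psiM mulr1 !scalerA; split; eexists.
Qed.

Lemma summand_mul i j a b : summand i a -> summand j b ->
  a * b = 0 \/ exists k, [/\ (k <= i)%O, (k <= j)%O & summand k (a * b)].
Proof.
move=> Ha Hb.
have [[ij|ji]|nij] := pselect ((i <= j)%O \/ (j <= i)%O); last first.
- left; have [[a' ->] [b' ->]] := (summand_psi Ha, summand_psi Hb).
  exact: psi_incomparable.
- by right; exists j; split=> //; case: (summand_mul_le ji Hb Ha).
- by right; exists i; split=> //; case: (summand_mul_le ij Ha Hb).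
Qed.

Lemma summand_neq0 i : exists2 a : cfm K X, summand i a & a != 0.
Proof.
have [x xi] := exists_index_in i.
have psi_nz (a : cfm K (Xindex aleph (upset i))) :
    a (restr xi) (restr xi) = 1 -> psi a != 0.
  move=> a1; apply/eqP => /cfmP/(_ x x)/eqP.
  by rewrite psiE (psi_funE _ xi xi) // a1 cfm0E oner_eq0.
have [imax|nmax] := pselect (max_elt i).
  exists (psi (1 : cfm K (Xindex aleph (upset i)))).
    by rewrite summand_maxE //; exists 1 => //; rewrite scale1r.
  by apply: psi_nz; rewrite cfm1E eqxx.
exists (psi (delta K (restr xi) (restr xi))).
  rewrite summand_nmaxE //; exists (delta K (restr xi) (restr xi)) => //.
  exact: delta_finite_rows.
by apply: psi_nz; rewrite deltaE !eqxx.
Qed.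

(** Whether row [x] of [psi a'] vanishes is governed by the restriction of [x] to $\{j\le\}$, which
    includes the value at [j], and [a'] has finitely many nonzero rows. *)
Lemma summand_row_values j a : ~ max_elt j -> summand j a ->
  finite_set [set supp_map x j | x in [set x | exists y, a x y != 0]].
Proof.
move=> nmax; rewrite summand_nmaxE // => -[a' fa' <-].
pose j' : upset j := exist _ j (lexx j).
apply: sub_finite_set (finite_image (fun u => supp_map u j') fa').
move=> _ [x [y xy] <-]; have xyt := psi_neq0 xy; have [xj yj _ _] := xyt.
exists (restr xj) => //; exists (restr yj).
by rewrite psiE (psi_funE a' xj yj xyt) in xy.
Qed.

(** Shrinking [q] to $X(k\le)$ and applying [psi] repeats it on every block of [k]; on the block of
    [x0] this returns [q]. *)
Lemma summand_extend k x0 (x0k : chain_of x0 k) (q : cfm K X) : ~ max_elt k ->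
    finite_rows q ->
    (forall x y, q x y != 0 -> same_tag k x0 x /\ same_tag k x0 y) ->
  exists2 r, summand k r &
    forall x y, same_tag k x0 x \/ same_tag k x0 y -> r x y = q x y.
Proof.
move=> nmax fq qtag; exists (psi (shrink q x0k)).
  rewrite summand_nmaxE //; exists (shrink q x0k) => //.
  have := finite_preimage (f := Defs.glue x0k)
    (fun u v _ _ => @glue_inj _ _ _ _ _ _ x0k u v) fq.
  by apply: sub_finite_set => u [v uv]; exists (Defs.glue x0k v).
move=> x y xy.
have [x0x|nx0x] := pselect (same_tag k x0 x); last first.
  have -> : q x y = 0 by apply/eqP; apply: contra_notT nx0x => /qtag[].
  apply/eqP; apply: contra_notT nx0x => /psi_neq0 txy.
  by case: xy => // x0y; exact: same_tag_trans x0y (same_tagC txy).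
have [x0y|nx0y] := pselect (same_tag k x0 y); last first.
  have -> : q x y = 0 by apply/eqP; apply: contra_notT nx0y => /qtag[].
  apply/eqP; apply: contra_notT nx0y => /psi_neq0 txy.
  exact: same_tag_trans x0x txy.
have [[_ xk _ _] [_ yk _ _]] := (x0x, x0y).
rewrite -{1}(glue_restr x0k xk x0x) -{1}(glue_restr x0k yk x0y).
have := congr1 (fun c : cfm K _ => c (restr xk) (restr yk))
  (shrink_psi (shrink q x0k) x0k).
rewrite -[LHS]/(psi _ _ _) => ->.
by rewrite -[LHS]/(q _ _) !glue_restr.
Qed.

(** As [k] lies below [s], whether a chain through [k] meets [s] is decided inside $\{k\le\}$. *)
Lemma diag_local (s : seq I) k : (forall j, j \in s -> (k <= j)%O) ->
  block_local k (diag K (cyl (fun j x => chain_of x j) s)).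
Proof.
move=> ks; split=> [x y xyk /diag_neq0[exy _]|x x' xk xk' u v].
  by subst y; case: xyk => xk; exact: same_tag_refl.
rewrite !diagE !(inj_eq (@glue_inj _ _ _ _ _ _ _)); congr ((_ && _)%:R).
have cylE z (zk : chain_of z k) : cyl (fun j x => chain_of x j) s (Defs.glue zk u) <->
    exists2 j : upset k, val j \in s & chain_of u j.
  split=> [[j js uj]|[j js uj]]; last by exists (val j) => //; exact/glue_val.
  by exists (exist _ j (ks _ js)) => //; apply/(glue_val zk u (exist _ j (ks _ js))).
by apply: asbool_equiv_eq; rewrite !cylE.
Qed.

Lemma diag_summand (s : seq I) j a : j \in s -> summand j a ->
  let W := diag K (cyl (fun j x => chain_of x j) s) in W * a = a /\ a * W = a.
Proof.
move=> js Ha /=; split; apply/cfmP => x y.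
  rewrite diagMl; have [->|axy] := eqVneq (a x y) 0; first by rewrite mulr0.
  rewrite asboolT ?mul1r //; exists j => //.
  by have [] := summand_tag Ha axy.
rewrite diagMr; have [->|axy] := eqVneq (a x y) 0; first by rewrite mul0r.
rewrite asboolT ?mulr1 //; exists j => //.
by have [] := summand_tag Ha axy.
Qed.

End Blocks.

(** * Elements of $\mathfrak B(I)$ on low blocks *)

Section FrakB.
Variables (d' : Order.disp_t) (aleph : bOrderType d') (K : fieldType).
Variables (d : Order.disp_t) (I : porderType d).
Hypothesis aleph_inf : infinite_set [set: aleph].
Local Notation X := (Xindex aleph I).
Implicit Types (x y z : X) (i j k : I) (a b m n q r : cfm K X).

(* Off [{i <=}] the map of an index can be chosen freely, so that a row of the
   topmost nonzero term [h i] avoids the finitely many rows of the terms below. *)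
Lemma sum_local_neq0 (F : {fset I}) (h : I -> cfm K X) k :
    (forall i, summand i (h i)) -> (forall i, i \in F -> (k <= i)%O) ->
    \sum_(i <- F) h i != 0 ->
  exists2 x, chain_of x k & exists y, (\sum_(i <- F) h i) x y != 0.
Proof.
move=> Hh kF sum0.
have [|i [iF /cfm_neq0[x0 [y0 hi0]]] imax] := @seq_maximal _ _ F (fun i => h i != 0).
  apply: contrapT => nF; case/eqP: sum0; rewrite big_seq big1 // => i iF.
  by apply/eqP; apply: contra_notT nF => hi; exists i.
(* A [j < i] is not maximal, so the nonzero rows of [h j] show only finitely many values at [j];
   [alpha] will avoid all of them. *)
pose bad := \bigcup_(j in [set` F] `&` [set j | (j < i)%O])
  [set supp_map x j | x in [set x | exists y, h j x y != 0]].
have fbad : finite_set bad.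
  apply: bigcup_finite => [|j [_ ji]].
    by apply: sub_finite_set (finite_fset F) => j [].
  apply: summand_row_values => // jmax.
  by move: (ji); rewrite /= (jmax _ (ltW ji)) ltxx.
have [alpha nbad] : exists alpha, ~ bad alpha.
  apply: contrapT => /forallNP nb; apply: aleph_inf.
  by apply: sub_finite_set fbad => t _; apply: contrapT; exact: nb.
pose p j := if j \in F then alpha else \bot%O.
have fp : fin_maps p.
  apply: sub_finite_set (finite_fset F) => j /=; rewrite /p.
  by case: ifP => // _; rewrite eqxx.
have [x1 [x1k x1i px1]] := exists_index (kF _ iF) fp.
have ti := summand_tag (Hh i) hi0; have [x0i y0i _ _] := ti.
(* A nonzero entry of [h i] is copied to the block of [x1], where the map has value [alpha] at the
   members of [F] strictly below [i]. *)
pose x := Defs.glue x1i (restr x0i); pose y := Defs.glue x1i (restr y0i).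
have hixy : h i x y = h i x0 y0.
  by apply: block_local_move ti; exact: summand_local (Hh i) (lexx i).
have tx : same_tag i x1 x by exact: glue_tag.
exists x; first by apply/(same_tag_chain tx (kF _ iF)).
exists y; rewrite cfm_sumE (big_fsetD1 i) //= big_seq big1 ?addr0 ?hixy //.
(* No other term contributes: it would put [j] on the chain of [x], and then [j > i] contradicts the
   choice of [i], while [j < i] contradicts that of [alpha]. *)
move=> j /fsetD1P[ji jF]; apply/eqP; apply: contraT => hjxy.
have hj0 : h j != 0 by apply: contraNneq hjxy => ->.
have [xj _ _ _] := summand_tag (Hh j) hjxy; have xi : chain_of x i by case: tx.
have [ij|ji'] := chain_total xi xj; first by rewrite (imax j jF hj0 ij) eqxx in ji.
have lji : (j < i)%O by rewrite lt_neqAle ji.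
case: nbad; exists j => //; exists x; first by exists y.
have [_ _ _ <-] := tx; first by rewrite px1 /p jF.
by rewrite lt_geF.
Qed.

(** Any [k] below [s] is allowed, so that one [k] can serve several elements at once. *)
Lemma frakB_local a : frakB_set a -> exists s : seq I,
  forall k, (forall i, i \in s -> (k <= i)%O) ->
    block_local k a /\ (a != 0 -> exists2 x, chain_of x k & exists y, a x y != 0).
Proof.
move=> [F [h [Hh ->]]]; exists F => k kF; split; last exact: sum_local_neq0.
rewrite big_seq; elim/big_ind: _ => [|b c|i iF].
- exact: block_local0.
- exact: block_localD.
- by apply: summand_local (Hh i) _; exact: kF.
Qed.

(** A nonzero entry of [b] is moved to position $(z,w)$ in the block of [x], where $a(x,y)\ne0$. An
    [r] acting there as the matrix unit at $(y,z)$ makes the entry of $arb$ at $(x,w)$ equal to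
    $a(x,y)b(z,w)$. *)
Lemma frakB_elementwise_prime a b : downward_directed I ->
    (exists i : I, ~ max_elt i) ->
    frakB_set a -> frakB_set b -> a != 0 -> b != 0 ->
  exists2 r, frakB_set r & a * r * b != 0.
Proof.
move=> dirI [i0 nmax0] /frakB_local[s sa] /frakB_local[t tb] a0 b0.
have [k ki0 kst] := directed_seq i0 (s ++ t) dirI.
have nmax := max_elt_ge nmax0 ki0.
have [|loca /(_ a0)[x xk [y axy]]] := sa k.
  by move=> i si; apply: kst; rewrite mem_cat si.
have [|locb /(_ b0)[x' x'k [y' bxy]]] := tb k.
  by move=> i ti; apply: kst; rewrite mem_cat ti orbT.
have tx' := block_local_tag locb x'k bxy; have [_ y'k _ _] := tx'.
pose z := Defs.glue xk (restr x'k); pose w := Defs.glue xk (restr y'k).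
have bzw : b z w != 0 by rewrite (block_local_move x'k y'k xk locb tx').
have [|u v|r Hr rq] := summand_extend (q := delta K y z) xk nmax.
- exact: delta_finite_rows.
- move=> /delta_neq0[-> ->]; split; last exact: glue_tag.
  exact: block_local_tag axy.
exists r; first exact: summand_frakB Hr.
apply/eqP => /cfmP/(_ x w)/eqP; rewrite cfm0E; apply/negP.
rewrite (@cfmM_eqr _ _ _ (a * r) (a * delta K y z)) => [|t' _].
  rewrite -mulrA cfmME (@fsum_supp _ _ [set y]) => [|t'].
    by rewrite fsbig_set1 deltaMl eqxx mul1r mulf_neq0.
  rewrite mulf_eq0 negb_or deltaMl => /andP[_].
  by case: (t' =P y) => //; rewrite mul0r eqxx.
by apply: cfmM_eql => t2 axt; apply: rq; left; exact: block_local_tag axt.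
Qed.

(* The block of [x0] at [k] increases as [k] decreases along the chain of [x0]. *)
Definition supported (x0 : X) (k : I) m :=
  forall x y, m x y != 0 -> same_tag k x0 x /\ same_tag k x0 y.

(** The left and right modules are cut out of these matrices by keeping only column [x0] or only row
    [x0]. *)
Definition germ (x0 : X) m := exists2 k, chain_of x0 k & supported x0 k m.

Lemma germ_delta x0 k x y : same_tag k x0 x -> same_tag k x0 y ->
  germ x0 (delta K x y).
Proof. by move=> kx ky; exists k => [|u v /delta_neq0[-> ->]//]; case: kx. Qed.

(** * Left and right modules attached to an index with coinitial chain *)

Section Germs.
Variable x0 : X.
Hypothesis x0_low : forall s : seq I,
  exists k, [/\ chain_of x0 k, ~ max_elt k & forall i, i \in s -> (k <= i)%O].

Lemma supported_le k l m : (k <= l)%O -> chain_of x0 k ->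
  supported x0 l m -> supported x0 k m.
Proof.
move=> kl x0k sm x y /sm[lx ly].
by split; [exact: same_tag_le lx|exact: same_tag_le ly].
Qed.

Lemma germ_zmod : germ x0 0 /\ forall m n, germ x0 m -> germ x0 n -> germ x0 (m - n).
Proof.
have [k0 [x0k0 _ _]] := x0_low [::].
split; first by exists k0 => // x y; rewrite cfm0E eqxx.
move=> m n [k _ mk] [l _ nl]; have [j [x0j _ jkl]] := x0_low [:: k; l].
exists j => // x y; rewrite cfmDE cfmNE; have [m0|mxy _] := eqVneq (m x y) 0.
  rewrite m0 sub0r oppr_eq0; apply: (supported_le _ x0j nl).
  by apply: jkl; rewrite !inE eqxx orbT.
by apply: (supported_le _ x0j mk) mxy; apply: jkl; rewrite !inE eqxx.
Qed.

(** For low [k], [r] is block-local at [k] and hence links the block of [x0] only to itself. *)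
Lemma germ_frakB r m : frakB_set r -> germ x0 m -> germ x0 (r * m) /\ germ x0 (m * r).
Proof.
move=> /frakB_local[s sr] [l _ ml]; have [k [x0k _ kls]] := x0_low (l :: s).
have [|locr _] := sr k; first by move=> i si; apply: kls; rewrite inE si orbT.
have mk : supported x0 k m.
  by apply: supported_le x0k ml; apply: kls; exact: mem_head.
split; exists k => // x y /cfmM_neq0[z].
  move=> rxz /mk[kz ky]; split=> //; apply: (same_tag_trans kz (same_tagC _)).
  by apply: (block_local_tagC locr) rxz; case: kz.
move=> /mk[kx kz] rzy; split=> //; apply: (same_tag_trans kz).
by apply: (block_local_tag locr) rzy; case: kz.
Qed.

Lemma germ_agree m n : germ x0 m -> germ x0 n -> exists2 k, ~ max_elt k &
  [/\ chain_of x0 k, supported x0 k m & supported x0 k n].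
Proof.
move=> [k _ mk] [l _ nl]; have [j [x0j nmax jkl]] := x0_low [:: k; l].
exists j => //; split=> //; [apply: supported_le x0j mk|apply: supported_le x0j nl];
  by apply: jkl; rewrite !inE eqxx ?orbT.
Qed.

(** With $c=m(y,x_0)\ne0$, the matrix $c^{-1}n\,e_{x_0,y}$ carries $m$ to $n$. It has finitely many
    nonzero rows and lives on one block, so some $r\in H(I,k)$ acts on $m$ in the same way. *)
Lemma germ_left_transitive m n : germ x0 m -> germ x0 n ->
    m = m * delta K x0 x0 -> n = n * delta K x0 x0 -> m != 0 ->
  exists2 r, frakB_set r & r * m = n.
Proof.
move=> gm gn mE nE /cfm_neq0[y [w myw]].
have {w myw} m0 : m y x0 != 0.
  by apply: contraNneq myw => m0; rewrite mE deltaMr m0 mul0r.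
have [k nmax [x0k mk nk]] := germ_agree gm gn.
have [|u v|r Hr rq] :=
    summand_extend (q := n * ((m y x0)^-1 *: delta K x0 y)) x0k nmax.
- by apply: finite_rowsMl; apply: finite_rowsZ; exact: delta_finite_rows.
- move=> /cfmM_neq0[t nut]; rewrite cfmZE mulf_eq0 negb_or => /andP[_ /delta_neq0[_ ->]].
  by split; [case: (nk _ _ nut)|case: (mk _ _ m0)].
exists r; first exact: summand_frakB Hr.
have -> : r * m = n * ((m y x0)^-1 *: delta K x0 y) * m.
  apply/cfmP => u v; apply: cfmM_eqr => z mzv; apply: rq; right.
  by case: (mk _ _ mzv).
rewrite -mulrA -scalerAl {2}mE mulrA delta_sandwich scalerA mulVf // scale1r.
by rewrite -nE.
Qed.

(** Mirror image, with $c^{-1}e_{y,x_0}n$ for $c=m(x_0,y)\ne0$. *)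
Lemma germ_right_transitive m n : germ x0 m -> germ x0 n ->
    m = delta K x0 x0 * m -> n = delta K x0 x0 * n -> m != 0 ->
  exists2 r, frakB_set r & m * r = n.
Proof.
move=> gm gn mE nE /cfm_neq0[w [y mwy]].
have {w mwy} m0 : m x0 y != 0.
  by apply: contraNneq mwy => m0; rewrite mE deltaMl m0 mulr0.
have [k nmax [x0k mk nk]] := germ_agree gm gn.
have [|u v|r Hr rq] :=
    summand_extend (q := ((m x0 y)^-1 *: delta K y x0) * n) x0k nmax.
- by apply: finite_rowsMr; apply: finite_rowsZ; exact: delta_finite_rows.
- move=> /cfmM_neq0[t]; rewrite cfmZE mulf_eq0 negb_or => /andP[_ /delta_neq0[-> _]] ntv.
  by split; [case: (mk _ _ m0)|case: (nk _ _ ntv)].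
exists r; first exact: summand_frakB Hr.
have -> : m * r = m * ((m x0 y)^-1 *: delta K y x0 * n).
  apply/cfmP => u v; apply: cfmM_eql => z muz; apply: rq; left.
  by case: (mk _ _ muz).
rewrite mulrA -scalerAr mE delta_sandwich scalerA -mE mulVf // scale1r.
by rewrite -nE.
Qed.

(** A nonzero entry is moved into the block of [x0]; the two matrix units then witness faithfulness
    on the right and on the left. *)
Lemma germ_faithful a : frakB_set a -> a != 0 -> exists x y,
  [/\ germ x0 (delta K x0 x), germ x0 (delta K y x0) & a x y != 0].
Proof.
move=> /frakB_local[s sa] a0; have [k [x0k _ ks]] := x0_low s.
have [loca /(_ a0)[x xk [y axy]]] := sa _ ks.
have txy := block_local_tag loca xk axy; have [_ yk _ _] := txy.
exists (Defs.glue x0k (restr xk)), (Defs.glue x0k (restr yk)).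
rewrite (block_local_move xk yk x0k loca txy); split=> //.
  by apply: germ_delta (same_tag_refl x0k) (glue_tag _ _).
by apply: germ_delta (glue_tag _ _) (same_tag_refl x0k).
Qed.

End Germs.

(** The single point left by directedness lies on every maximal chain, so $\psi(\mathbf 1)$ is the
    identity matrix. *)
Lemma frakB_scalar a : downward_directed I -> (forall i : I, max_elt i) ->
  frakB_set a -> exists c : K, a = c *: 1.
Proof.
move=> dirI maxI [F [h [Hh ->]]].
have {}Hh i : exists c : K, h i = c *: 1.
  have := Hh i; rewrite summand_maxE // => -[c _ <-]; exists c; congr (_ *: _).
  apply/cfmP => x y; rewrite psi1E cfm1E asboolT //.
  have /maxchainsP[_] := chain_ofP x; apply=> j _.
  by rewrite (directed_max_elt i j dirI maxI); left.
elim/big_ind: _ => [|b c [k ->] [l ->]|i _]; last exact: Hh.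
  by exists 0; rewrite scale0r.
by exists (k + l); rewrite scalerDl.
Qed.

End FrakB.

(** * Primeness and primitivity of $\mathfrak B(I)$ *)

Section Main.
Variables (d' : Order.disp_t) (aleph : bOrderType d') (K : fieldType).
Variables (d : Order.disp_t) (I : porderType d).
Hypothesis aleph_inf : infinite_set [set: aleph].
Variables (I0 : [set: I] !=set0) (hcof : has_finite_cofinal I).
Local Notation B := (frakB aleph K I0 hcof).
Local Notation Q := (cfm K (Xindex aleph I)).
Implicit Types r : B.

Local Notation phi := (val : B -> Q).

Lemma frakB_valP r : frakB_set (phi r).
Proof. exact/asboolP/(valP r). Qed.

Lemma frakB_lift (a : Q) : frakB_set a -> exists r, phi r = a.
Proof. by move=> /asboolP Ba; exists (FrakB (I0 := I0) (hI := hcof) Ba). Qed.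

Lemma frakB_val_neq0 r : r != 0 -> phi r != 0.
Proof. by apply: contra_neq => r0; apply: val_inj. Qed.

Lemma frakB_span r : exists (s : seq I) (h : I -> Q),
  (forall i, summand i (h i)) /\ phi r = \sum_(i <- s) h i.
Proof. by have [F [h [Hh e]]] := frakB_valP r; exists F, h. Qed.

Lemma frakB_summand_lift i (a : Q) : summand i a -> exists r, phi r = a.
Proof. by move=> /summand_frakB; exact: frakB_lift. Qed.

Lemma left_primitive_coinitial : left_primitive B -> has_coinitial_chain I.
Proof.
apply: (@primitive_coinitial _ _ B Q phi (@summand _ _ _ _ _)
  val_inj _ _ frakB_summand_lift frakB_span _ _ (Xindex aleph I)
  (fun i x => chain_of x i) (@diag _ _)) => //.
- by move=> i j a b; exact: summand_mul.
- exact: summand_neq0.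
- by move=> x i j; exact: chain_total.
- exact: diag0.
- exact: diagT.
- exact: diagI.
- by move=> s j a js Ha; case: (diag_summand js Ha).
- by move=> s k a nmax ks Ha; case: (local_mul_summand nmax (diag_local aleph K ks) Ha).
Qed.

(** The left-hand argument run in the converse rings: the factors in each product change places. *)
Lemma right_primitive_coinitial : right_primitive B -> has_coinitial_chain I.
Proof.
apply: (@primitive_coinitial _ _ B^c Q^c phi (@summand _ _ _ _ _)
  val_inj _ _ frakB_summand_lift frakB_span _ _ (Xindex aleph I)
  (fun i x => chain_of x i) (@diag _ _)) => //.
- move=> i j a b Ha Hb; have [ba0|[k [ki kj Hk]]] := summand_mul Hb Ha; first by left.
  by right; exists k.
- exact: summand_neq0.
- by move=> x i j; exact: chain_total.
- exact: diag0.
- exact: diagT.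
- by move=> S T; rewrite setIC diagI.
- by move=> s j a js Ha; case: (diag_summand js Ha).
- by move=> s k a nmax ks Ha; case: (local_mul_summand nmax (diag_local aleph K ks) Ha).
Qed.

Lemma prime_directed : elementwise_prime B -> downward_directed I.
Proof.
apply: (@elementwise_prime_directed _ _ B Q phi (@summand _ _ _ _ _)
  val_inj _ _ frakB_summand_lift frakB_span) => //.
- by move=> i j a b; exact: summand_mul.
- exact: summand_neq0.
Qed.

Lemma frakB_neq0 : exists r, r != 0.
Proof. by exists 1; apply/eqP => /(congr1 phi)/eqP; rewrite oner_eq0. Qed.

Lemma max_elt_primitive : downward_directed I -> (forall i : I, max_elt i) ->
  left_primitive B /\ right_primitive B.
Proof.
move=> dirI maxI; have one_neq0 : 1 != 0 :> B.
  by apply/eqP => /(congr1 phi)/eqP; rewrite oner_eq0.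
have inv r : r != 0 -> exists s, s * r = 1 /\ r * s = 1.
  move=> r0; have [c cE] := frakB_scalar dirI maxI (frakB_valP r).
  have rE : r = c *: 1 by apply: val_inj.
  have c0 : c != 0 by apply: contra_neq r0 => e; rewrite rE e scale0r.
  exists (c^-1 *: 1); rewrite rE -!scalerAl !mul1r !scalerA mulVf // mulfV //.
  by rewrite scale1r.
split; apply: left_primitive_division => // r /inv[s [sr rs]]; by exists s.
Qed.

Lemma directed_prime : downward_directed I -> elementwise_prime B.
Proof.
move=> dirI; have [nmax|maxI] := max_elt_dichotomy I; last first.
  by have [/left_primitive_elementwise_prime] := max_elt_primitive dirI maxI.
move=> a b /frakB_val_neq0 a0 /frakB_val_neq0 b0.
have [r Br arb] := frakB_elementwise_prime aleph_inf dirI nmax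
  (frakB_valP a) (frakB_valP b) a0 b0.
have [s sE] := frakB_lift Br; exists s; apply: contra_neq arb => e.
by rewrite -sE -[LHS]/(phi (a * s * b)) e.
Qed.

(** The index [x0] pairs the zero map with a maximal chain containing the coinitial one; going below
    [i0] as well secures nonmaximality. *)
Lemma coinitial_low : has_coinitial_chain I -> (exists i : I, ~ max_elt i) ->
  exists x0 : Xindex aleph I, forall s : seq I,
    exists k, [/\ chain_of x0 k, ~ max_elt k & forall i, i \in s -> (k <= i)%O].
Proof.
move=> coI [i0 nmax0]; have dirI := coinitial_chain_directed coI.
have [C chC coC] := coI; have [A mA CA] := chain_extend chC.
exists (SigSub (mem_set (@fin_maps_bot _ aleph _ I)), SigSub (mem_set mA)) => s.
have [m mi0 ms] := directed_seq i0 s dirI; have [k Ck km] := coC m.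
exists k; split=> [|| i /ms]; [exact: CA| |exact: le_trans].
by apply: max_elt_ge nmax0 _; exact: le_trans mi0.
Qed.

Lemma coinitial_left_primitive : has_coinitial_chain I -> left_primitive B.
Proof.
move=> coI; have [nmax|maxI] := max_elt_dichotomy I; last first.
  by have [lp rp] := max_elt_primitive (coinitial_chain_directed coI) maxI.
have [x0 low] := coinitial_low coI nmax.
(* Column vectors supported on one block of [x0], written as matrices with column [x0] only. *)
pose M : {pred Q} := fun m => `[< germ x0 m /\ m = m * delta K x0 x0 >].
have Mzmod : zmod_closed M.
  have [g0 gB] := germ_zmod K low.
  split=> [|m n /asboolP[gm mE] /asboolP[gn nE]]; apply/asboolP; split=> //.
  - by rewrite mul0r.
  - exact: gB.
  - by rewrite mulrBl -mE -nE.
have Mstable r m : m \in M -> phi r * m \in M.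
  move=> /asboolP[gm mE]; apply/asboolP; split; last by rewrite -mulrA -mE.
  by case: (germ_frakB aleph_inf low (frakB_valP r) gm).
apply: (@left_primitive_subgroup B Q phi erefl _ _ M Mzmod Mstable) => //.
- exists (delta K x0 x0).
    apply/asboolP; split; last by rewrite [RHS]deltaM.
    have [k [x0k _ _]] := low [::].
    exact: germ_delta (same_tag_refl x0k) (same_tag_refl x0k).
  by apply/eqP => /cfmP/(_ x0 x0)/eqP; rewrite deltaE !eqxx oner_eq0.
- move=> m n /asboolP[gm mE] /asboolP[gn nE] m0.
  have [r Br rm] := germ_left_transitive low gm gn mE nE m0.
  by have [s sE] := frakB_lift Br; exists s; rewrite sE.
move=> r r0.
have [x [y [_ gy rxy]]] := germ_faithful aleph_inf low (frakB_valP r) (frakB_val_neq0 r0).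
exists (delta K y x0).
  by apply/asboolP; split=> //; rewrite [RHS]deltaM.
by apply/eqP => /cfmP/(_ x x0)/eqP; rewrite deltaMr eqxx mulr1 cfm0E; exact/negP.
Qed.

Lemma coinitial_right_primitive : has_coinitial_chain I -> right_primitive B.
Proof.
move=> coI; have [nmax|maxI] := max_elt_dichotomy I; last first.
  by have [lp rp] := max_elt_primitive (coinitial_chain_directed coI) maxI.
have [x0 low] := coinitial_low coI nmax.
(* Row vectors here: matrices with row [x0] only. *)
pose M : {pred Q^c} := fun m => `[< germ x0 m /\ m = delta K x0 x0 * m :> Q >].
have Mzmod : zmod_closed M.
  have [g0 gB] := germ_zmod K low.
  split=> [|m n /asboolP[gm mE] /asboolP[gn nE]]; apply/asboolP; split=> //.
  - by rewrite mulr0.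
  - exact: gB.
  - by rewrite [RHS]mulrBr -mE -nE.
have Mstable (r : B^c) (m : Q^c) : m \in M -> (phi r : Q^c) * m \in M.
  move=> /asboolP[gm mE]; apply/asboolP; split; last by rewrite [RHS]mulrA -mE.
  by case: (germ_frakB aleph_inf low (frakB_valP r) gm).
apply: (@left_primitive_subgroup B^c Q^c phi erefl _ _ M Mzmod Mstable) => //.
- exists (delta K x0 x0).
    apply/asboolP; split; last by rewrite [RHS]deltaM.
    have [k [x0k _ _]] := low [::].
    exact: germ_delta (same_tag_refl x0k) (same_tag_refl x0k).
  by apply/eqP => /cfmP/(_ x0 x0)/eqP; rewrite deltaE !eqxx oner_eq0.
- move=> m n /asboolP[gm mE] /asboolP[gn nE] m0.
  have [r Br rm] := germ_right_transitive low gm gn mE nE m0.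
  by have [s sE] := frakB_lift Br; exists s; rewrite sE.
move=> r r0.
have [x [y [gx _ rxy]]] := germ_faithful aleph_inf low (frakB_valP r) (frakB_val_neq0 r0).
exists (delta K x0 x).
  by apply/asboolP; split=> //; rewrite [RHS]deltaM.
apply/eqP => /cfmP/(_ x0 y)/eqP.
by rewrite [X in X == _]deltaMl eqxx mul1r cfm0E; exact/negP.
Qed.

End Main.

Theorem corollary6p5 (d' : Order.disp_t) (aleph : bOrderType d')
    (haleph : infinite_cardinal aleph) (K : fieldType)
    (d : Order.disp_t) (I : porderType d) (hI : aleph_poset aleph I)
    (I0 : [set: I] !=set0) (hcof : has_finite_cofinal I) :
  (prime_ring (frakB aleph K I0 hcof) <-> downward_directed I) /\
  ((right_primitive (frakB aleph K I0 hcof) <-> has_coinitial_chain I) /\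
   (has_coinitial_chain I <-> left_primitive (frakB aleph K I0 hcof))).
Proof.
have [_ _ aleph_inf] := haleph; split; last split; split.
- by move=> /prime_ringP[_]; exact: prime_directed.
- move=> dirI; apply/prime_ringP; split; first exact: frakB_neq0.
  exact: directed_prime.
- exact: right_primitive_coinitial.
- exact: coinitial_right_primitive.
- exact: coinitial_left_primitive.
- exact: left_primitive_coinitial.
Qed.
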